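(* Let $(M,\nabla)$ be a flat manifold and let $\phi\in\Gamma(\otimes^3T^*M)$ satisfy $$\phi(x,y,z)=\phi(x,z,y)-\phi(z,x,y)$$ for all vector fields $x,y,z$ on $M$; regard $\phi$ also as a map $(x,y)\mapsto\phi(x,y)\in\Omega^1(M)$, $\langle\phi(x,y),z\rangle=\phi(x,y,z)$. Put $\tilde\phi(x,y,z)=\phi(x,z,y)$, so that $\tilde\phi\in\Gamma(\wedge^2T^*M\otimes T^*M)$. On $TM\oplus T^*M$ consider the nondegenerate skew-symmetric bilinear form $(x+\xi,y+\eta)_-=\langle\xi,y\rangle-\langle\eta,x\rangle$, the projection $\rho:TM\oplus T^*M\to TM$ to the first summand, and the multiplication $$(x+\xi)\star(y+\eta)=\nabla_xy+\mathcal L_x\eta-R_y^*\xi-\tfrac12\,\mathrm d(x+\xi,y+\eta)_++\phi(x,y),$$ where $(x+\xi,y+\eta)_+=\langle\xi,y\rangle+\langle\eta,x\rangle$. Then $(TM\oplus T^*M,\star,\rho,(\cdot,\cdot)_-)$ is a pre-symplectic algebroid if and only if $\tilde\phi$ is closed, i.e. $\delta\tilde\phi=0$, where $\delta$ is the coboundary operator associated to the left-symmetric algebroid $T_\nabla M$.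
   Context: All vector bundles are real, of finite rank, over the smooth manifold $M$; bundle maps cover the identity of $M$. A flat manifold $(M,\nabla)$ is a smooth manifold with a flat torsion free connection $\nabla$ on $TM$; $T_\nabla M=(TM,\nabla,\mathrm{id})$ is the left-symmetric algebroid with product $x\cdot y=\nabla_xy$ and anchor the identity. For vector fields $x,y,z$ and 1-forms $\xi$, $\mathcal L_x\xi$ is the usual Lie derivative, $\mathrm d$ is the usual exterior derivative of functions, and $\langle R_y^*\xi,z\rangle=-\langle\xi,\nabla_zy\rangle$. The coboundary $\delta:\Gamma(\wedge^{2}T^*M\otimes T^*M)\to\Gamma(\wedge^3T^*M\otimes T^*M)$ is, for vector fields $x_1,\dots,x_4$, $$\delta\varphi(x_1,\dots,x_4)=\sum_{i=1}^3(-1)^{i+1}x_i\varphi(x_1,\dots,\hat{x_i},\dots,x_4)-\sum_{i=1}^3(-1)^{i+1}\varphi(x_1,\dots,\hat{x_i},\dots,x_3,\nabla_{x_i}x_4)+\sum_{1\le i<j\le3}(-1)^{i+j}\varphi([x_i,x_j],x_1,\dots,\hat{x_i},\dots,\hat{x_j},\dots,x_4).$$ A pre-symplectic algebroid $(E,\star,\rho,(\cdot,\cdot)_-)$ is a vector bundle $E\to M$ equipped with a nondegenerate skew-symmetric ($C^\infty(M)$-)bilinear form $(\cdot,\cdot)_-$, an ($\mathbb R$-bilinear) multiplication $\star:\Gamma(E)\times\Gamma(E)\to\Gamma(E)$ and a bundle map $\rho:E\to TM$ such that for all $e_1,e_2,e_3\in\Gamma(E)$: (i) $(e_1,e_2,e_3)-(e_2,e_1,e_3)=\frac16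 D\,T(e_1,e_2,e_3)$; (ii) $\rho(e_1)(e_2,e_3)_-=(e_1\star e_2-\frac12D(e_1,e_2)_-,\,e_3)_-+(e_2,[e_1,e_3]_E)_-$. Here $(e_1,e_2,e_3)=e_1\star(e_2\star e_3)-(e_1\star e_2)\star e_3$; $T(e_1,e_2,e_3)=(e_1\star e_2,e_3)_-+(e_1,e_2\star e_3)_--(e_2\star e_1,e_3)_--(e_2,e_1\star e_3)_-\in C^\infty(M)$; $D:C^\infty(M)\to\Gamma(E)$ is defined by $(Df,e)_-=\rho(e)(f)$; and $[e_1,e_2]_E=e_1\star e_2-e_2\star e_1$. *)

(* Defs.v *)
(* MathComp-Analysis: smooth manifolds and vector bundles over R : realType. *)
From HB Require Import structures.
From mathcomp Require Import all_boot all_order all_algebra.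
From mathcomp Require Import all_classical all_reals all_analysis.
Set Implicit Arguments.
Unset Strict Implicit.
Unset Printing Implicit Defensive.
Import Order.TTheory GRing.Theory Num.Theory.
Import numFieldNormedType.Exports.
Local Open Scope classical_set_scope.
Local Open Scope ring_scope.

(* Only used with U open: k.+1 means differentiable on U with every
   directional derivative of class C^k. *)
Fixpoint class_C {R : realType} {n : nat} {V : normedModType R}
    (k : nat) (U : set 'rV[R]_n) (f : 'rV[R]_n -> V) : Prop :=
  if k is k'.+1 then
    (forall a, U a -> differentiable f a) /\
    (forall v, class_C k' U (fun a => 'D_v f a))
  else forall a, U a -> {for a, continuous f}.

Definition smooth_in {R : realType} {n : nat} {V : normedModType R}
    (U : set 'rV[R]_n) (f : 'rV[R]_n -> V) : Prop :=
  forall k, class_C k U f.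

(* A homeomorphism from the open set dom onto the open set coord @` dom, with
   inverse param; both maps are total, with arbitrary values elsewhere. *)
Record chart (R : realType) (n : nat) (T : topologicalType) := Chart {
  dom : set T;
  coord : T -> 'rV[R]_n;
  param : 'rV[R]_n -> T;
  open_dom : open dom;
  open_coord_dom : open (coord @` dom);
  coordK : forall p, dom p -> param (coord p) = p;
  coord_continuous : forall p, dom p -> {for p, continuous coord};
  param_continuous : forall p, dom p -> {for coord p, continuous param} }.

(* The atlas need not be maximal: it generates the smooth structure. *)
Record manifold (R : realType) (n : nat) := Manifold {
  carrier :> topologicalType;
  carrier_hausdorff : hausdorff_space carrier;
  carrier_second_countable : @second_countable carrier;
  atlas : set (chart R n carrier);
  atlas_cover : forall p, exists2 c, atlas c & dom c p;
  atlas_smooth : forall c c', atlas c -> atlas c' ->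
    smooth_in (coord c @` (dom c `&` dom c')) (coord c' \o param c) }.

Section Manifold.
Context {R : realType} {n : nat} (M : manifold R n).

Definition smooth_on {V : normedModType R} (W : set M) (f : M -> V) : Prop :=
  forall c, atlas c -> smooth_in (coord c @` (W `&` dom c)) (f \o param c).

Definition smooth_fun (f : M -> R) : Prop := smooth_on setT f.

Definition chart_at (p : M) : chart R n M := projT1 (cid2 (atlas_cover p)).

(* T_p M is R^n, a tangent vector being given by its components in the chart
   chart_at p. The components in another chart are obtained through the
   differential of the transition map, see the trivializations of
   tangent_bundle. *)
Definition tangent (p : M) : vectType R := 'rV[R]_n.

Definition cotangent (p : M) : vectType R := 'Hom(tangent p, R^o).

(* the derivative at p along v of a map defined and smooth near p *)
Definition deriv_along {V : normedModType R} (p : M) (v : tangent p)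
    (f : M -> V) : V :=
  'D_(v : 'rV[R]_n) (f \o param (chart_at p)) (coord (chart_at p) p).

(* A vector bundle presented by its fibres and local trivializations, which
   determine the topology and smooth structure of the total space. Only the
   values of triv i on triv_dom i matter. The axioms are in vector_bundle. *)
Record bundle := Bundle {
  rank : nat;
  fiber : M -> vectType R;
  triv_index : Type;
  triv_dom : triv_index -> set M;
  triv : triv_index -> forall p, 'Hom(fiber p, 'rV[R]_rank) }.

Definition frame (E : bundle) (i : triv_index E) (p : M) :
  'Hom('rV[R]_(rank E), fiber E p) := (triv i p)^-1%VF.

Record vector_bundle (E : bundle) : Prop := VectorBundle {
  triv_open : forall i : triv_index E, open (triv_dom i);
  triv_cover : forall p, exists i : triv_index E, triv_dom i p;
  triv_bij : forall (i : triv_index E) p, triv_dom i p -> bijective (triv i p);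
  triv_smooth : forall (i j : triv_index E) (w : 'rV[R]_(rank E)),
    smooth_on (triv_dom i `&` triv_dom j)
      (fun p => triv j p (frame i p w)) }.

Definition section (E : bundle) := forall p, fiber E p.

Definition smooth_section (E : bundle) (s : section E) : Prop :=
  forall i : triv_index E, smooth_on (triv_dom i) (fun p => triv i p (s p)).

(* The trivialization given by the chart c maps v in T_p M to the value at v of
   the differential of c. *)
Definition tangent_bundle : bundle :=
  @Bundle n tangent {c : chart R n M | atlas c} (fun c => dom (sval c))
    (fun c p => linfun (fun v : tangent p => deriv_along v (coord (sval c)))).

Definition dual_bundle (E : bundle) : bundle :=
  @Bundle (rank E) (fun p => 'Hom(fiber E p, R^o)) (triv_index E)
    (@triv_dom E)
    (fun i p => linfun (fun xi : 'Hom(fiber E p, R^o) =>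
       \row_k (xi (frame i p (delta_mx 0 k)) : R))).

Definition sum_bundle (E F : bundle) : bundle :=
  @Bundle (rank E + rank F) (fun p => (fiber E p * fiber F p)%type)
    (triv_index E * triv_index F)
    (fun ij => triv_dom ij.1 `&` triv_dom ij.2)
    (fun ij p => linfun (fun u : fiber E p * fiber F p =>
       row_mx (triv ij.1 p u.1) (triv ij.2 p u.2))).

Definition cotangent_bundle : bundle := dual_bundle tangent_bundle.

Definition vfield := forall p, tangent p.
Definition form1 := forall p, cotangent p.

Definition smooth_vfield (x : vfield) : Prop := @smooth_section tangent_bundle x.

Definition act (x : vfield) (f : M -> R) : M -> R :=
  fun p => deriv_along (x p) f.

Definition differential (f : M -> R) : form1 :=
  fun p => linfun (fun v : tangent p => deriv_along v f : R^o).

Definition pairing (xi : form1) (x : vfield) : M -> R := fun p => xi p (x p).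

(* q |-> the components of x q in the chart chart_at p, for q near p *)
Definition vlocal (p : M) (x : vfield) : M -> 'rV[R]_n :=
  fun q => deriv_along (x q) (coord (chart_at p)).

(* the tangent vector at q with given components in the chart chart_at p *)
Definition at_frame (p q : M) : 'Hom('rV[R]_n, tangent q) :=
  (linfun (fun v : tangent q => deriv_along v (coord (chart_at p))))^-1%VF.

(* [x, y]^i = x^j d_j y^i - y^j d_j x^i *)
Definition lie_bracket (x y : vfield) : vfield :=
  fun p => deriv_along (x p) (vlocal p y) - deriv_along (y p) (vlocal p x).

(* (L_x eta)_i = x^j d_j eta_i + eta_j d_i x^j, contracted with v^i *)
Definition lie_deriv (x : vfield) (eta : form1) : form1 :=
  fun p => linfun (fun v : tangent p =>
    (deriv_along (x p) (fun q => eta q (at_frame p q v) : R)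
     + eta p (deriv_along v (vlocal p x)) : R^o)).

(* A connection on TM as a map from vector fields y to fields of endomorphisms
   v |-> nabla_v y. *)
Definition connection_map := vfield -> forall p, 'End(tangent p).

Definition covar (nabla : connection_map) (x y : vfield) : vfield :=
  fun p => nabla y p (x p).

Record connection (nabla : connection_map) : Prop := Connection {
  covar_smooth : forall x y, smooth_vfield x -> smooth_vfield y ->
    smooth_vfield (covar nabla x y);
  nabla_add : forall y z, smooth_vfield y -> smooth_vfield z ->
    forall p, nabla (fun q => y q + z q) p = nabla y p + nabla z p;
  nabla_leibniz : forall f y, smooth_fun f -> smooth_vfield y ->
    forall p (v : tangent p), nabla (fun q => f q *: y q) p v =
      deriv_along v f *: y p + f p *: nabla y p v }.

Definition flat (nabla : connection_map) : Prop :=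
  forall x y z, smooth_vfield x -> smooth_vfield y -> smooth_vfield z ->
  forall p, covar nabla x (covar nabla y z) p
            - covar nabla y (covar nabla x z) p
            - covar nabla (lie_bracket x y) z p = 0.

Definition torsion_free (nabla : connection_map) : Prop :=
  forall x y, smooth_vfield x -> smooth_vfield y ->
  forall p, covar nabla x y p - covar nabla y x p = lie_bracket x y p.

(* <R_y^* xi, z> = - <xi, nabla_z y> *)
Definition Rstar (nabla : connection_map) (y : vfield) (xi : form1) : form1 :=
  fun p => - (xi p \o nabla y p)%VF.

(* Sections of the third tensor power of T^*M, as fields of trilinear maps *)
Definition tensor3 :=
  forall p, 'Hom(tangent p, 'Hom(tangent p, cotangent p)).

Definition smooth_tensor3 (phi : tensor3) : Prop :=
  forall (c : triv_index tangent_bundle) (u v w : 'rV[R]_n),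
  smooth_on (triv_dom c)
    (fun p => phi p (frame c p u) (frame c p v) (frame c p w) : R).

(* delta of T_nabla M on sections of L^2 T^*M (x) T^*M, given by their values
   on vector fields *)
Definition coboundary (nabla : connection_map)
    (phi : vfield -> vfield -> vfield -> M -> R)
    (x1 x2 x3 x4 : vfield) (p : M) : R :=
  act x1 (phi x2 x3 x4) p - act x2 (phi x1 x3 x4) p + act x3 (phi x1 x2 x4) p
  - (phi x2 x3 (covar nabla x1 x4) p - phi x1 x3 (covar nabla x2 x4) p
     + phi x1 x2 (covar nabla x3 x4) p)
  + (- phi (lie_bracket x1 x2) x3 x4 p + phi (lie_bracket x1 x3) x2 x4 p
     - phi (lie_bracket x2 x3) x1 x4 p).

Definition closed_cochain (nabla : connection_map)
    (phi : vfield -> vfield -> vfield -> M -> R) : Prop :=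
  forall x1 x2 x3 x4, smooth_vfield x1 -> smooth_vfield x2 ->
  smooth_vfield x3 -> smooth_vfield x4 ->
  forall p, coboundary nabla phi x1 x2 x3 x4 p = 0.

Section PreSymplecticAlgebroid.
Variables (E : bundle) (star : section E -> section E -> section E).
Variables (rho : forall p, 'Hom(fiber E p, tangent p)).
Variables (form : forall p, fiber E p -> fiber E p -> R).

Definition sform (e1 e2 : section E) : M -> R :=
  fun p => form (e1 p) (e2 p).

Definition anchor (e : section E) : vfield := fun p => rho p (e p).

(* (D f, e) = rho(e)(f); well defined when form is nondegenerate *)
Definition gradient (f : M -> R) : section E :=
  fun p => xget 0 [set d : fiber E p |
    forall e : fiber E p, form d e = deriv_along (rho p e) f].

Definition star_bracket (e1 e2 : section E) : section E :=
  fun p => star e1 e2 p - star e2 e1 p.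

Definition associator (e1 e2 e3 : section E) : section E :=
  fun p => star e1 (star e2 e3) p - star (star e1 e2) e3 p.

Definition Tfun (e1 e2 e3 : section E) : M -> R :=
  fun p => sform (star e1 e2) e3 p + sform e1 (star e2 e3) p
           - sform (star e2 e1) e3 p - sform e2 (star e1 e3) p.

Record pre_symplectic_algebroid : Prop := PreSymplecticAlgebroid {
  psa_bundle : vector_bundle E;
  (* linearity in the second argument follows from form_skew *)
  form_linear : forall p (a : R) (u u' v : fiber E p),
    form (a *: u + u') v = a * form u v + form u' v;
  form_skew : forall p (u v : fiber E p), form u v = - form v u;
  form_nondegenerate : forall p (u : fiber E p),
    (forall v, form u v = 0) -> u = 0;
  form_smooth : forall (i : triv_index E) (w w' : 'rV[R]_(rank E)),
    smooth_on (triv_dom i) (fun p => form (frame i p w) (frame i p w'));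
  rho_smooth : forall (i : triv_index E) (c : triv_index tangent_bundle)
      (w : 'rV[R]_(rank E)),
    smooth_on (triv_dom i `&` triv_dom c)
      (fun p => triv c p (rho p (frame i p w)));
  star_smooth : forall e1 e2, smooth_section e1 -> smooth_section e2 ->
    smooth_section (star e1 e2);
  star_linearl : forall (a : R) e1 e1' e2, smooth_section e1 ->
    smooth_section e1' -> smooth_section e2 -> forall p,
    star (fun q => a *: e1 q + e1' q) e2 p = a *: star e1 e2 p + star e1' e2 p;
  star_linearr : forall (a : R) e1 e2 e2', smooth_section e1 ->
    smooth_section e2 -> smooth_section e2' -> forall p,
    star e1 (fun q => a *: e2 q + e2' q) p = a *: star e1 e2 p + star e1 e2' p;
  star_associator : forall e1 e2 e3, smooth_section e1 ->
    smooth_section e2 -> smooth_section e3 -> forall p,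
    associator e1 e2 e3 p - associator e2 e1 e3 p =
    6%:R^-1 *: gradient (Tfun e1 e2 e3) p;
  star_invariant : forall e1 e2 e3, smooth_section e1 ->
    smooth_section e2 -> smooth_section e3 -> forall p,
    act (anchor e1) (sform e2 e3) p =
    sform (fun q => star e1 e2 q - 2%:R^-1 *: gradient (sform e1 e2) q) e3 p
    + sform e2 (star_bracket e1 e3) p }.

End PreSymplecticAlgebroid.

Definition TTstar : bundle := sum_bundle tangent_bundle cotangent_bundle.

Definition vpart (e : section TTstar) : vfield := fun p => (e p).1.
Definition fpart (e : section TTstar) : form1 := fun p => (e p).2.

Definition TTstar_form (p : M) (u v : fiber TTstar p) : R :=
  u.2 v.1 - v.2 u.1.

Definition TTstar_plus (e1 e2 : section TTstar) : M -> R :=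
  fun p => pairing (fpart e1) (vpart e2) p + pairing (fpart e2) (vpart e1) p.

Definition TTstar_rho (p : M) : 'Hom(fiber TTstar p, tangent p) :=
  linfun (fun u : fiber TTstar p => u.1).

Definition TTstar_star (nabla : connection_map) (phi : tensor3)
    (e1 e2 : section TTstar) : section TTstar :=
  let x := vpart e1 in let xi := fpart e1 in
  let y := vpart e2 in let eta := fpart e2 in
  fun p => (covar nabla x y p,
    lie_deriv x eta p - Rstar nabla y xi p
    - 2%:R^-1 *: differential (TTstar_plus e1 e2) p + phi p (x p) (y p)).

Definition tensor_swap (phi : tensor3) (x y z : vfield) : M -> R :=
  fun p => phi p (x p) (z p) (y p).

End Manifold.

(* Main.v *)
Require Import Defs.
From HB Require Import structures.
From mathcomp Require Import all_boot all_order all_algebra.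
From mathcomp Require Import all_classical all_reals all_analysis.
From mathcomp Require Import ring lra.
(* A second import, so that coord denotes the map of a chart. *)
Require Import Defs.
Set Implicit Arguments.
Unset Strict Implicit.
Unset Printing Implicit Defensive.
Import Order.TTheory GRing.Theory Num.Theory.
Import numFieldNormedType.Exports.
Local Open Scope classical_set_scope.
Local Open Scope ring_scope.

(** Write e_i = x_i + xi_i and abbreviate nabla_x y by xy. Vanishing torsion
    turns the 1-form part of the product into an expression in nabla alone:
      < (x + xi) * (y + eta), z > = x<eta, z> - <eta, xz> + <eta, zx>
         + <xi, zy> - 1/2 (z<xi, y> + z<eta, x>) + phi(x, y, z)
    (star_fpart). The two axioms of a pre-symplectic algebroid, for the
    invariance of the form and for the associator, are then identities between
    functions built from these terms by derivations, flatness being used in the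
    form x(yz) - y(xz) = (xy)z - (yx)z.

    In the invariance axiom everything cancels up to
      phi(x1, x2, x3) - phi(x1, x3, x2) + phi(x3, x1, x2),
    which is zero by the symmetry of phi, so this axiom always holds
    (star_invariance). In the associator axiom the vector part is flatness. In
    the 1-form part, evaluated on z, the terms that contain a xi_i cancel because
    of flatness and of [x, y] = xy - yx acting on functions. The symmetry of phi
    makes phi antisymmetric in its outer arguments with vanishing cyclic sum, so
    that phi contributes -3 phi(x2, x3, x1) to T, and the remaining terms add up
    to the coboundary of the swapped tensor at (x1, x2, z, x3)
    (star_associator_defect, associator_defect). Hence the axiom holds for all
    sections if and only if the coboundary vanishes; taking xi_i = 0 gives one
    direction.

    To test a 1-form on a tangent vector, or the smoothness of a section in a
    chart, one needs global vector fields with prescribed values, because nabla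
    acts on global fields only. They are obtained by cutting off coordinate
    fields (extend_frame). This is where bump functions and the Hausdorff
    property enter. The rest of the analysis is the stability of the class C^k
    under products and composition, and the symmetry of second derivatives, by
    which the bracket acts as a commutator (act_bracket). *)

(** * Directional derivatives and maps of class C^k *)

Section NormedCalculus.
Context {R : realType}.
Implicit Types V W : normedModType R.

(** Differentiability is an expansion at one point, so it only sees the
    germ. *)
Lemma near_eq_differentiable V W (f g : V -> W) (a : V) :
  {near a, f =1 g} -> differentiable f a -> differentiable g a.
Proof.
move=> fg df.
have [cdf /eqaddoP Hf] := (diff_locallyP a f).1 df.
have Hg : g \o shift a = cst (g a) + 'd f a +o_ (0 : V) id.
  apply/eqaddoP => e e0; have fga := nbhs_singleton fg.
  have fg0 : \forall h \near (0 : V), f (h + a) = g (h + a).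
    by move: fg; rewrite (near_shift 0 a) /= subr0.
  near=> h.
  have <- : (f \o shift a - (cst (f a) + 'd f a)) h =
     (g \o shift a - (cst (g a) + 'd f a)) h.
    rewrite !fctE /= fga; congr (_ - _); near: h; exact: fg0.
  by near: h; exact: (Hf e e0).
have dE : 'd g a = 'd f a :> (V -> W) by apply: diff_unique.
by apply/diff_locallyP; rewrite dE.
Unshelve. all: by end_near. Qed.

Lemma differentiable_rV V n (F : V -> 'rV[R]_n) a :
  (forall j, differentiable (fun x => F x 0 j) a) -> differentiable F a.
Proof.
move=> dF.
rewrite (_ : F = \sum_(j < n) (fun x => F x 0 j *: 'e_j)); last first.
  by apply/funext => x; rewrite fct_sumE -row_sum_delta.
by apply: differentiable_sum => j; apply: differentiableZl; exact: dF.
Qed.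

Lemma differentiable_entry V n (F : V -> 'rV[R]_n) a j :
  differentiable F a -> differentiable (fun x => F x 0 j) a.
Proof.
move=> dF; apply: (@differentiable_comp _ _ _ _ F (fun N : 'rV[R]_n => N 0 j : R)) => //.
exact: differentiable_coord.
Qed.

Lemma derive_entry V n (F : V -> 'rV[R]_n) a v j :
  differentiable F a -> ('D_v F a) 0 j = 'D_v (fun x => F x 0 j) a.
Proof. by move=> dF; rewrite derive_mx ?mxE //; exact: diff_derivable. Qed.

Lemma derive_comp V W V' (f : V -> W) (g : W -> V') a v :
  differentiable f a -> differentiable g (f a) ->
  'D_v (g \o f) a = 'D_('D_v f a) g (f a).
Proof.
move=> df dg; have dgf := differentiable_comp df dg.
by rewrite (deriveE _ dgf) (deriveE _ dg) (deriveE _ df) diff_comp.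
Qed.

Lemma derive_linear V W (f : V -> W) a : differentiable f a ->
  linear (fun v => 'D_v f a).
Proof. by move=> df k u v; rewrite !deriveE // linearP. Qed.

Lemma derive_vectZ V W (f : V -> W) a (k : R) u : differentiable f a ->
  'D_(k *: u) f a = k *: 'D_u f a.
Proof. by move=> df; rewrite !deriveE // linearZ. Qed.

Lemma derive_sum_coord V n (f : 'rV[R]_n -> V) a v : differentiable f a ->
  'D_v f a = \sum_(j < n) v 0 j *: 'D_('e_j) f a.
Proof.
move=> df; rewrite deriveE // {1}(row_sum_delta v) linear_sum.
by apply: eq_bigr => j _; rewrite linearZ deriveE.
Qed.

End NormedCalculus.

Section ClassC.
Context {R : realType} {n : nat}.
Implicit Types (V : normedModType R) (U : set 'rV[R]_n) (k : nat).

Lemma class_C_sub V k U U' (f : 'rV[R]_n -> V) :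
  U' `<=` U -> class_C k U f -> class_C k U' f.
Proof.
move=> UU; elim: k f => [|k IH] f /=; first by move=> H a /UU /H.
by move=> [H1 H2]; split=> [a /UU /H1|v]; [|exact: IH].
Qed.

(** The successor case of the class concerns derivatives at points of U,
    which depend on f near these points: this is why U has to be open. *)
Lemma class_C_eq V k U (f g : 'rV[R]_n -> V) : open U ->
  (forall a, U a -> f a = g a) -> class_C k U f -> class_C k U g.
Proof.
move=> oU; have near_fg (f' g' : 'rV[R]_n -> V) : (forall a, U a -> f' a = g' a) ->
    forall a, U a -> {near a, f' =1 g'}.
  by move=> fg a Ua; apply: filterS (open_nbhs_nbhs (conj oU Ua)); exact: fg.
elim: k f g => [|k IH] f g /= fg.
  move=> H a Ua; move: (H a Ua); rewrite /prop_for /continuous_at -(fg a Ua).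
  apply: cvg_trans; apply: (@near_eq_cvg _ _ (nbhs a)); exact: near_fg fg a Ua.
move=> [H1 H2]; split=> [a Ua|v].
  by apply: near_eq_differentiable (H1 a Ua); exact: near_fg fg a Ua.
apply: IH (H2 v) => a Ua; apply: near_eq_derive; exact: near_fg fg a Ua.
Qed.

Lemma class_C_pred V k U (f : 'rV[R]_n -> V) :
  class_C k.+1 U f -> class_C k U f.
Proof.
elim: k f => [|k IH] f.
  by move=> [H _] a Ua; apply: differentiable_continuous; exact: H.
by move=> [H1 H2]; split=> // v; apply: IH; exact: H2.
Qed.

(** Hence smoothness on an open set amounts to smoothness of the germs at its
    points, see smooth_in_near. *)
Lemma class_C_local V k U (f : 'rV[R]_n -> V) :
  (forall a, U a -> exists2 U', U' a & class_C k U' f) -> class_C k U f.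
Proof.
elim: k f => [|k IH] f /= H; first by move=> a /H [U' U'a]; exact.
split=> [a /H [U' U'a []]|v]; first by move/(_ a U'a).
by apply: IH => a /H [U' U'a [_ H']]; exists U'.
Qed.

Lemma class_C_cst V k U (c : V) : class_C k U (fun=> c).
Proof.
elim: k c => [|k IH] c /=; first by move=> a _; exact: (@cst_continuous _ _ c).
split=> [a _|v]; first exact: differentiable_cst.
suff -> : 'D_v (fun=> c) = fun=> 0 by exact: IH.
by apply/funext => a; exact: derive_cst.
Qed.

Lemma class_CD V k U (f g : 'rV[R]_n -> V) : open U ->
  class_C k U f -> class_C k U g -> class_C k U (fun a => f a + g a).
Proof.
move=> oU; elim: k f g => [|k IH] f g /=.
  by move=> H1 H2 a Ua; apply: (@continuousD _ _ _ f g a); [exact: H1|exact: H2].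
move=> [f1 f2] [g1 g2]; split=> [a Ua|v].
  by apply: (@differentiableD _ _ _ f g); [exact: f1|exact: g1].
apply: (@class_C_eq _ _ _ (fun a => 'D_v f a + 'D_v g a)) => // [a Ua|].
  by rewrite -deriveD //; apply: diff_derivable; [exact: f1|exact: g1].
exact: IH.
Qed.

(** By induction on k through the Leibniz rule; the induction also needs f
    and g themselves to be of the lower class. *)
Lemma class_CM k U (f g : 'rV[R]_n -> R) : open U ->
  class_C k U f -> class_C k U g -> class_C k U (fun a => f a * g a).
Proof.
move=> oU; elim: k f g => [|k IH] f g.
  by move=> H1 H2 a Ua; apply: (@continuousM _ _ f g a); [exact: H1|exact: H2].
move=> Cf Cg; case: (Cf) (Cg) => [f1 f2] [g1 g2]; split=> [a Ua|v].
  by apply: (@differentiableM _ _ f g); [exact: f1|exact: g1].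
apply: (@class_C_eq _ _ _ (fun a => f a * 'D_v g a + g a * 'D_v f a)) => // [a Ua|].
  have -> : (fun a => f a * g a) = f * g by [].
  by rewrite deriveM //; apply: diff_derivable; [exact: f1|exact: g1].
apply: class_CD => //; apply: IH.
- exact: class_C_pred Cf.
- exact: g2.
- exact: class_C_pred Cg.
- exact: f2.
Qed.

(** Products and compositions are treated for real functions; row-valued maps
    are reached through their entries. *)
Lemma class_C_rV m k U (F : 'rV[R]_n -> 'rV[R]_m) : open U ->
  class_C k U F <-> forall j, class_C k U (fun a => F a 0 j).
Proof.
move=> oU; elim: k F => [|k IH] F; split.
- move=> H j a Ua.
  apply: (@continuous_comp _ _ _ F (fun N : 'rV[R]_m => N 0 j)); first exact: H.
  exact: matrix_normedtype.coord_continuous.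
- move=> H a Ua.
  have -> : F = \sum_(j < m) (fun x => F x 0 j *: ('e_j : 'rV[R]_m)).
    by apply/funext => x; rewrite fct_sumE -row_sum_delta.
  elim/big_ind : _ => [|f g Hf Hg|j _]; first exact: (@cst_continuous _ _ 0).
    exact: continuousD.
  by apply: continuousZr_tmp; exact: H.
- move=> [H1 H2] j; split=> [a Ua|v]; first exact/differentiable_entry/H1.
  apply: (@class_C_eq _ _ _ (fun a => 'D_v F a 0 j)) => // [a Ua|].
    by rewrite derive_entry //; exact: H1.
  by have [+ _] := IH ('D_v F); apply; exact: H2.
- move=> H; have dF a : U a -> differentiable F a.
    by move=> Ua; apply: differentiable_rV => j; case: (H j) => + _; exact.
  split=> // v; apply/IH => j.
  apply: (@class_C_eq _ _ _ (fun a => 'D_v (fun x => F x 0 j) a)) => // [a Ua|].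
    by rewrite derive_entry //; exact: dF.
  by have [_ Hj] := H j; exact: Hj.
Qed.

End ClassC.

Lemma class_C_sum {R : realType} {n : nat} (I : Type) (r : seq I) k
   (U : set 'rV[R]_n) (f : I -> 'rV[R]_n -> R) : open U ->
  (forall i, class_C k U (f i)) -> class_C k U (fun a => \sum_(i <- r) f i a).
Proof.
move=> oU H; elim: r => [|i r IH].
  by under eq_fun do rewrite big_nil; exact: class_C_cst.
by under eq_fun do rewrite big_cons; exact: class_CD.
Qed.

(** Induction on k for all f at once: the derivatives of f o g are sums of
    products of derivatives of g with (D_j f) o g, and D_j f is one class
    lower. *)
Lemma class_C_comp {R : realType} {n m : nat} k
  (U : set 'rV[R]_n) (U' : set 'rV[R]_m) (g : 'rV[R]_n -> 'rV[R]_m)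
  (f : 'rV[R]_m -> R) : open U -> open U' ->
  (forall a, U a -> U' (g a)) -> class_C k U g -> class_C k U' f ->
  class_C k U (f \o g).
Proof.
move=> oU oU' gU; elim: k f => [|k IH] f.
  by move=> Cg Cf a Ua; apply: continuous_comp; [exact: Cg|exact/Cf/gU].
move=> Cg; case: (Cg) => g1 g2 [f1 f2]; split=> [a Ua|v].
  by apply: differentiable_comp; [exact: g1|exact/f1/gU].
apply: (@class_C_eq _ _ _ _ _ (fun a => \sum_(j < m) 'D_v g a 0 j * 'D_('e_j) f (g a))).
- by [].
- move=> a Ua; rewrite [RHS]derive_comp; [|exact: g1|exact/f1/gU].
  by rewrite [RHS]derive_sum_coord //; exact/f1/gU.
apply: class_C_sum => // j; apply: class_CM => //.
  by have [+ _] := class_C_rV k ('D_v g) oU; apply; exact: g2.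
apply: (IH (fun b => 'D_('e_j) f b)) => //; [exact: class_C_pred|exact: f2].
Qed.

(** * Germs of smooth maps and symmetry of second derivatives *)

(** Continuity is only known at the points of A, as for the maps of a chart. *)
Lemma open_preimage_in (T T' : topologicalType) (f : T -> T') (A : set T) (B : set T') :
  open A -> open B -> (forall x, A x -> {for x, continuous f}) ->
  open (A `&` f @^-1` B).
Proof.
move=> oA oB cf; rewrite openE => x [Ax Bfx]; rewrite /interior.
by apply: filterI; [exact: open_nbhs_nbhs|apply: (cf x Ax); exact: open_nbhs_nbhs].
Qed.

Section Germ.
Context {R : realType} {n : nat}.
Implicit Types (V : normedModType R) (U : set 'rV[R]_n).

(** Smoothness of the germ at a point. Working with germs removes the
    bookkeeping of domains: sums, products and compositions only ask for
    smoothness at the point in question. *)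
Definition smooth_near V (f : 'rV[R]_n -> V) (a : 'rV[R]_n) :=
  exists U, [/\ open U, U a & smooth_in U f].

Lemma smooth_near_eq V (f g : 'rV[R]_n -> V) a :
  {near a, f =1 g} -> smooth_near f a -> smooth_near g a.
Proof.
move=> fg [U [oU Ua sf]].
have : nbhs a [set b | f b = g b] by exact: fg.
rewrite nbhsE => -[W [oW Wa] Wfg]; exists (U `&` W); split=> //.
  exact: openI.
move=> k; apply: (@class_C_eq _ _ _ _ _ f); first exact: openI.
  by move=> b [_ /Wfg].
by apply: class_C_sub (sf k) => b [].
Qed.

Lemma smooth_near_differentiable V (f : 'rV[R]_n -> V) a :
  smooth_near f a -> differentiable f a.
Proof. by move=> [U [oU Ua sf]]; have [+ _] := sf 1%N; exact. Qed.

Lemma smooth_near_derive V (f : 'rV[R]_n -> V) a v :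
  smooth_near f a -> smooth_near ('D_v f) a.
Proof.
move=> [U [oU Ua sf]]; exists U; split=> // k.
by have [_ +] := sf k.+1; exact.
Qed.

Lemma smooth_near_near V (f : 'rV[R]_n -> V) a :
  smooth_near f a -> \forall b \near a, smooth_near f b.
Proof.
move=> [U [oU Ua sf]]; apply: filterS (open_nbhs_nbhs (conj oU Ua)) => b Ub.
by exists U.
Qed.

Lemma smooth_in_near V U (f : 'rV[R]_n -> V) : open U ->
  smooth_in U f <-> forall a, U a -> smooth_near f a.
Proof.
move=> oU; split=> [sf a Ua|sf k]; first by exists U.
by apply: class_C_local => a /sf [W [_ Wa sW]]; exists W.
Qed.

Lemma smooth_near_cst V (c : V) a : smooth_near (fun=> c) a.
Proof. by exists setT; split=> // [|k]; [exact: openT|exact: class_C_cst]. Qed.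

Lemma smooth_nearD V (f g : 'rV[R]_n -> V) a :
  smooth_near f a -> smooth_near g a -> smooth_near (fun b => f b + g b) a.
Proof.
move=> [U [oU Ua sf]] [W [oW Wa sg]]; exists (U `&` W); split=> //.
  exact: openI.
move=> k; apply: class_CD; first exact: openI.
  by apply: class_C_sub (sf k) => b [].
by apply: class_C_sub (sg k) => b [].
Qed.

Lemma smooth_nearM (f g : 'rV[R]_n -> R) a :
  smooth_near f a -> smooth_near g a -> smooth_near (fun b => f b * g b) a.
Proof.
move=> [U [oU Ua sf]] [W [oW Wa sg]]; exists (U `&` W); split=> //.
  exact: openI.
move=> k; apply: class_CM; first exact: openI.
  by apply: class_C_sub (sf k) => b [].
by apply: class_C_sub (sg k) => b [].
Qed.

Lemma smooth_near_sum (I : Type) (r : seq I) (f : I -> 'rV[R]_n -> R) a :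
  (forall i, smooth_near (f i) a) -> smooth_near (fun b => \sum_(i <- r) f i b) a.
Proof.
move=> H; elim: r => [|i r IH].
  by under eq_fun do rewrite big_nil; exact: smooth_near_cst.
by under eq_fun do rewrite big_cons; exact: smooth_nearD.
Qed.

Lemma smooth_near_rV m (F : 'rV[R]_n -> 'rV[R]_m) a :
  smooth_near F a <-> forall j, smooth_near (fun b => F b 0 j) a.
Proof.
split=> [[U [oU Ua sF]] j|H].
  exists U; split=> // k.
  by have [+ _] := class_C_rV k F oU; move=> /(_ (sF k)) /(_ j).
pose Uj j := sval (cid (H j)).
have UjP j : [/\ open (Uj j), Uj j a & smooth_in (Uj j) (fun b => F b 0 j)].
  by rewrite /Uj; case: cid.
pose W := [set b | forall j, Uj j b].
have oW : open W.
  rewrite openE => b Wb.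
  apply: (@filter_forall _ _ Uj (nbhs b) (nbhs_filter b)) => j.
  by apply: open_nbhs_nbhs; split; [case: (UjP j)|exact: Wb].
exists W; split=> // [j|k]; first by case: (UjP j).
apply/class_C_rV => // j; have [_ _ /(_ k)] := UjP j.
by apply: class_C_sub => b; exact.
Qed.

Lemma smooth_near_coord j a : smooth_near (fun b : 'rV[R]_n => b 0 j : R) a.
Proof.
exists setT; split=> //; first exact: openT.
case=> [|k]; first by move=> b _; exact: matrix_normedtype.coord_continuous.
split=> [b _|v]; first exact: differentiable_coord.
suff -> : 'D_v (fun b : 'rV[R]_n => b 0 j : R) = fun=> v 0 j.
  exact: class_C_cst.
apply/funext => b; rewrite -(derive_entry _ _ (F := id)) //.
by rewrite derive_id.
Qed.

End Germ.

Lemma smooth_near_comp {R : realType} {n m : nat} (g : 'rV[R]_n -> 'rV[R]_m)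
  (f : 'rV[R]_m -> R) a :
  smooth_near g a -> smooth_near f (g a) -> smooth_near (f \o g) a.
Proof.
move=> [U [oU Ua sg]] [W [oW Wa sf]].
have oUW : open (U `&` g @^-1` W) by apply: open_preimage_in => //; exact: (sg 0%N).
exists (U `&` g @^-1` W); split=> // k.
apply: (class_C_comp oUW oW) => [b []|| ]; [by []| |exact: sf].
by apply: (@class_C_sub _ _ _ _ U) (sg k) => b [].
Qed.

Section Schwarz.
Context {R : realType} {n : nat}.
Implicit Types (F : 'rV[R]_n -> R) (a u v : 'rV[R]_n).

Lemma is_derive_line F a u (t : R) : differentiable F (a + t *: u) ->
  is_derive t 1 (fun s : R => F (a + s *: u)) ('D_u F (a + t *: u)).
Proof.
move=> dF.
have dl : differentiable (fun s : R => a + s *: u) t.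
  apply: (@differentiableD _ _ _ (cst a) (fun s : R => s *: u)); first exact: differentiable_cst.
  by apply: differentiableZl; exact: ex_diff.
have Dl : 'D_(1 : R) (fun s : R => a + s *: u) t = u.
  rewrite (_ : (fun s : R => _) = cst a + (fun s : R => s *: u)) //.
  rewrite deriveD; [|exact: derivable_cst|].
    rewrite derive_cst add0r.
    rewrite deriveE; last by apply: differentiableZl; exact: ex_diff.
    have -> : 'd (fun s : R => s *: u) t = ( *:%R^~ u) :> (R -> _) by exact: diff_val.
    by rewrite scale1r.
  by apply: diff_derivable; apply: differentiableZl; exact: ex_diff.
apply: DeriveDef.
  by apply: diff_derivable; apply: (@differentiable_comp _ _ _ _ (fun s : R => a + s *: u) F).
by rewrite (@derive_comp _ _ _ _ (fun s : R => a + s *: u) F) // Dl.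
Qed.

Lemma mean_value_line F a u (s : R) : 0 < s ->
  (forall t, 0 <= t <= s -> differentiable F (a + t *: u)) ->
  exists2 t, 0 <= t <= s & F (a + s *: u) - F a = s * 'D_u F (a + t *: u).
Proof.
move=> s0 dF.
have [||t] := @MVT R (fun t => F (a + t *: u)) (fun t => 'D_u F (a + t *: u)) 0 s s0.
- move=> t; rewrite in_itv /= => /andP[t0 ts]; apply: is_derive_line.
  by apply: dF; rewrite !ltW.
- apply: continuous_in_subspaceT => t; rewrite inE /= in_itv /= => ht.
  apply: differentiable_continuous; apply/derivable1_diffP.
  by have [] := is_derive_line (dF t ht).
rewrite in_itv /= => /andP[t0 ts] E; exists t; first by rewrite !ltW.
by move: E; rewrite scale0r addr0 subr0 => ->; rewrite mulrC.
Qed.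

(** The mean value theorem is applied twice: to b |-> F(b + s v) - F(b)
    along u, then to D_u F along v. *)
Lemma second_difference F a u v (s : R) : 0 < s ->
  (forall t r, 0 <= t <= s -> 0 <= r <= s ->
     smooth_near F (a + t *: u + r *: v)) ->
  exists t r, [/\ 0 <= t <= s, 0 <= r <= s &
   F (a + s *: u + s *: v) - F (a + s *: u) - F (a + s *: v) + F a =
   s ^+ 2 * 'D_v ('D_u F) (a + t *: u + r *: v)].
Proof.
move=> s0 sF.
have h0 : 0 <= (0 : R) <= s by rewrite lexx ltW.
have hs : 0 <= s <= s by rewrite lexx ltW.
pose G b := F (b + s *: v) - F b.
have dshift b : differentiable (fun b : 'rV[R]_n => b + s *: v) b.
  apply: (@differentiableD _ _ _ id (cst (s *: v))); first exact: ex_diff.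
  exact: differentiable_cst.
have dFs t : 0 <= t <= s -> differentiable (F \o (fun b => b + s *: v)) (a + t *: u).
  move=> ht; apply: differentiable_comp => //.
  by apply: smooth_near_differentiable; exact: sF.
have dF t : 0 <= t <= s -> differentiable F (a + t *: u).
  move=> ht; have := sF t 0 ht h0; rewrite scale0r addr0.
  exact: smooth_near_differentiable.
have dG t : 0 <= t <= s -> differentiable G (a + t *: u).
  move=> ht; apply: (@differentiableB _ _ _ (F \o (fun b => b + s *: v)) F).
    exact: dFs.
  exact: dF.
have [t ht Et] := mean_value_line s0 dG.
have [r hr Er] : exists2 r, 0 <= r <= s & 'D_u F (a + t *: u + s *: v) - 'D_u F (a + t *: u)
     = s * 'D_v ('D_u F) (a + t *: u + r *: v).
  apply: (@mean_value_line ('D_u F) (a + t *: u) v s s0) => r hr.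
  by have /smooth_near_differentiable := smooth_near_derive u (sF t r ht hr).
exists t, r; split=> //.
have DG : 'D_u G (a + t *: u) = 'D_u F (a + t *: u + s *: v) - 'D_u F (a + t *: u).
  rewrite (_ : G = (F \o (fun b => b + s *: v)) - F) //.
  rewrite deriveB; [|by apply: diff_derivable; exact: dFs|by apply: diff_derivable; exact: dF].
  congr (_ - _); rewrite derive_comp //; last first.
    by apply: smooth_near_differentiable; exact: sF.
  congr ('D_ _ _ _).
  rewrite (_ : (fun b : 'rV[R]_n => b + s *: v) = id + cst (s *: v)) //.
  by rewrite deriveD // derive_id derive_cst addr0.
rewrite expr2 -mulrA -Er -DG -Et /G; ring.
Qed.

Lemma small_parallelogram a u v (W : set 'rV[R]_n) : nbhs a W ->
  exists2 s : R, 0 < s & forall t r, 0 <= t <= s -> 0 <= r <= s ->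
    W (a + t *: u + r *: v).
Proof.
move=> /nbhs_ballP [e /= e0 aW].
pose C := `|u| + `|v| + 1.
have C0 : 0 < C by rewrite /C; have := normr_ge0 u; have := normr_ge0 v; lra.
(* |t u + r v| <= s (|u| + |v|) < e *)
exists (e / C / 2); first by rewrite !divr_gt0.
move=> t r /andP[t0 ts] /andP[r0 rs]; apply: aW.
rewrite -ball_normE /ball_ /= -addrA opprD addrA subrr add0r normrN.
apply: le_lt_trans (ler_normD _ _) _; rewrite !normrZ !ger0_norm //.
apply: (@le_lt_trans _ _ (e / C / 2 * C)).
  have := ler_wpM2r (normr_ge0 u) ts; have := ler_wpM2r (normr_ge0 v) rs.
  have : 0 <= e / C / 2 by rewrite !divr_ge0 // ltW.
  rewrite /C; nra.
by rewrite mulrAC divfK ?gt_eqF //; lra.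
Qed.

Lemma dist_lt_half (x y z e : R) :
  `|x - z| < e / 2 -> `|y - z| < e / 2 -> `|x - y| < e.
Proof.
move=> xz yz; rewrite (_ : x - y = (x - z) - (y - z)); last by ring.
by apply: le_lt_trans (ler_normB _ _) _; lra.
Qed.

(** The second difference over a small parallelogram is symmetric in u and
    v, while second_difference evaluates it by either mixed derivative at a
    nearby point; continuity of the two mixed derivatives concludes. *)
Lemma schwarz F a u v : smooth_near F a ->
  'D_u ('D_v F) a = 'D_v ('D_u F) a.
Proof.
move=> sF; apply/eqP; rewrite -subr_eq0 -normr_le0; apply/ler_addgt0Pr => e e0.
rewrite add0r.
have cuv (w w' : 'rV[R]_n) : {for a, continuous ('D_w ('D_w' F))}.
  apply: differentiable_continuous; apply: smooth_near_differentiable.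
  by do 2! apply: smooth_near_derive.
have e2 : 0 < e / 2 by lra.
have Nvu : \forall b \near a, `|'D_v ('D_u F) a - 'D_v ('D_u F) b| < e / 2.
  by move/cvgrPdist_lt: (cuv v u) => /(_ _ e2).
have Nuv : \forall b \near a, `|'D_u ('D_v F) a - 'D_u ('D_v F) b| < e / 2.
  by move/cvgrPdist_lt: (cuv u v) => /(_ _ e2).
have : \forall b \near a, [/\ smooth_near F b,
   `|'D_v ('D_u F) a - 'D_v ('D_u F) b| < e / 2 &
   `|'D_u ('D_v F) a - 'D_u ('D_v F) b| < e / 2].
  by apply: filterS3 (smooth_near_near sF) Nvu Nuv => b H1 H2 H3; split.
move=> /(small_parallelogram u v) [s s0 Hs].
have [t [r [ht hr E1]]] := @second_difference F a u v s s0
  (fun t r ht hr => let: And3 H _ _ := Hs t r ht hr in H).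
have [|r' [t' [hr' ht' E2]]] := @second_difference F a v u s s0.
  by move=> t' r' ht' hr'; rewrite addrAC; case: (Hs r' t' hr' ht').
have [_ N1 _] := Hs t r ht hr; have [_ _ N2] := Hs t' r' ht' hr'.
have P : a + r' *: v + t' *: u = a + t' *: u + r' *: v by exact: addrAC.
have Q : a + s *: v + s *: u = a + s *: u + s *: v by exact: addrAC.
rewrite P Q in E2.
have E : 'D_v ('D_u F) (a + t *: u + r *: v) = 'D_u ('D_v F) (a + t' *: u + r' *: v).
  have sn0 : s ^+ 2 != 0 by rewrite expf_neq0 // gt_eqF.
  apply: (mulfI sn0); apply: etrans (esym E1) _; apply: etrans _ E2.
  by congr (_ + _); exact: addrAC.
rewrite E in N1; apply: ltW.
exact: dist_lt_half N2 N1.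
Qed.

End Schwarz.

(** * Bump functions *)

Section Flat.
Context {R : realType}.

(** The family x^-j exp(-1/x), extended by 0 to x <= 0, is closed under
    differentiation up to linear combinations; hence all its members are
    smooth. *)
Definition flat_exp (j : nat) (x : R) : R :=
  if 0 < x then x^-1 ^+ j * expR (- x^-1) else 0.

Lemma flat_exp_npos j x : x <= 0 -> flat_exp j x = 0.
Proof. by rewrite /flat_exp; case: ltgtP. Qed.

Lemma flat_exp_pos j x : 0 < x -> flat_exp j x = x^-1 ^+ j * expR (- x^-1).
Proof. by rewrite /flat_exp => ->. Qed.

(** From exp(y) = exp(y/m)^m >= (y/m)^m. *)
Lemma exp_bound (y : R) (m : nat) : 0 < y ->
  y ^+ m * expR (- y) <= m%:R ^+ m.
Proof.
move=> y0; case: m => [|m].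
  by rewrite !expr0 mul1r -expR0 ler_expR; lra.
have m0 : (0 : R) < m.+1%:R by rewrite ltr0n.
rewrite expRN -ler_pdivlMr ?invr_gt0 ?expR_gt0 // invrK.
have -> : y = m.+1%:R * (y / m.+1%:R) by rewrite mulrC divfK ?gt_eqF.
rewrite expRM_natl exprMn; apply: ler_wpM2l; first by rewrite exprn_ge0 // ltW.
have ym : 0 <= y / m.+1%:R by rewrite divr_ge0 ?ltW.
rewrite ler_pXn2r ?nnegrE // ?expR_ge0 //.
by apply: le_trans (expR_ge1Dx _); rewrite lerDr.
Qed.

(** Gives at once continuity and a vanishing derivative at the origin. *)
Lemma flat_exp_quadratic j (x : R) : `|flat_exp j x| <= j.+2%:R ^+ j.+2 * x ^+ 2.
Proof.
rewrite /flat_exp; case: ltP => [x0|_]; last first.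
  by rewrite normr0 mulr_ge0 ?sqr_ge0 ?exprn_ge0 ?ler0n.
have y0 : 0 < x^-1 by rewrite invr_gt0.
rewrite ger0_norm; last by rewrite mulr_ge0 ?exprn_ge0 ?expR_ge0 ?ltW.
rewrite -ler_pdivrMr ?exprn_gt0 //; apply: le_trans (exp_bound j.+2 y0).
by rewrite -(exprVn x) mulrAC -exprD addn2.
Qed.

Lemma is_derive_quadratic (f : R -> R) (C : R) :
  (forall x, `|f x| <= C * x ^+ 2) -> is_derive (0 : R) 1 f 0.
Proof.
move=> Hf.
have f0 : f 0 = 0 by apply/eqP; rewrite -normr_le0; have := Hf 0; rewrite expr0n mulr0.
have C0 : 0 <= C by have := Hf 1; rewrite expr1n mulr1; apply: le_trans.
have H : h^-1 *: (f (h *: (1 : R) + 0) - f 0) @[h --> (0 : R)^'] --> (0 : R).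
  apply/cvgrPdist_lt => e e0.
  have d0 : 0 < e / (C + 1) by rewrite divr_gt0 //; lra.
  near=> h.
  have hn0 : h != 0 by near: h; exact: nbhs_dnbhs_neq.
  have hd : `|h| < e / (C + 1) by near: h; exact: dnbhs0_lt.
  rewrite f0 subr0 addr0 sub0r normrN [_%:A]mulr1 normrM normfV.
  have h0 : 0 < `|h| by rewrite normr_gt0.
  rewrite ltr_pdivrMl //; apply: le_lt_trans (Hf h) _.
  rewrite -real_normK ?num_real // expr2 mulrA [ltRHS]mulrC ltr_pM2r //.
  move: hd; rewrite ltr_pdivlMr; last lra.
  by move=> hd; apply: le_lt_trans hd; have := ltW h0; nra.
by apply: DeriveDef; [apply/cvg_ex; exists 0|apply: cvg_lim].
Unshelve. all: by end_near. Qed.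

Lemma is_derive_flat_exp j (x : R) :
  is_derive x 1 (flat_exp j) (flat_exp j.+2 x - j%:R * flat_exp j.+1 x).
Proof.
have [x0|x0|->] := ltgtP x 0.
- rewrite !flat_exp_npos ?(ltW x0) // mulr0 subr0.
  apply: (@near_eq_is_derive _ _ _ (cst 0)).
  near=> y; rewrite flat_exp_npos // ltW //.
  by near: y; exact: lt_nbhsl.
- have xn0 : x != 0 by rewrite gt_eqF.
  have HV : is_derive x (1 : R) (fun y : R => y^-1) (- x ^- 2 *: 1).
    exact: (@is_deriveV _ id).
  have HX := is_deriveX j HV.
  have HE := @is_derive1_comp R expR (- (fun y : R => y^-1)) x _ _
    (is_derive_expR (- x^-1)) (is_deriveN HV).
  have HM := is_deriveM HX HE.
  apply: (@near_eq_is_derive _ _ _ ((fun y : R => y^-1) ^+ j * (expR \o (- (fun y : R => y^-1))))).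
    near=> y; rewrite flat_exp_pos; last by near: y; exact: lt_nbhsr.
    by rewrite !fctE.
  apply: is_derive_eq HM _.
  rewrite !flat_exp_pos // !fctE /=.
  case: j {HX} => [|j]; rewrite /GRing.scale /= -exprVn.
    by rewrite !mul0r !expr0; ring.
  by rewrite !exprS; ring.
- rewrite !flat_exp_npos // mulr0 subr0.
  exact: is_derive_quadratic (flat_exp_quadratic j).
Unshelve. all: by end_near. Qed.

Lemma flat_exp0_lt x y : 0 < y -> x < y -> flat_exp 0 x < flat_exp 0 y.
Proof.
move=> y0 xy; rewrite /flat_exp y0 !expr0 !mul1r; case: ifP => x0; last exact: expR_gt0.
by rewrite ltr_expR ltrN2 ltf_pV2.
Qed.

(** Constant and positive on x <= 0 and zero on x >= 1. Composing the flat
    exponential with itself avoids the usual quotient of two bump functions. *)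
Definition plateau (t : R) : R := flat_exp 0 (flat_exp 0 1 - flat_exp 0 t).

Lemma plateau_le0 t : t <= 0 -> plateau t = plateau 0.
Proof. by move=> t0; rewrite /plateau !(flat_exp_npos 0 t0, flat_exp_npos 0 (lexx 0)). Qed.

Lemma plateau_ge1 t : 1 <= t -> plateau t = 0.
Proof.
rewrite le_eqVlt => /orP[/eqP <-|t1]; rewrite /plateau {1}/flat_exp.
  by rewrite subrr ltxx.
have t0 : 0 < t by lra.
by have := flat_exp0_lt t0 t1; case: ifP => //; lra.
Qed.

Lemma plateau0_gt0 : 0 < plateau 0.
Proof.
rewrite /plateau {3}/flat_exp ltxx subr0.
have H : 0 < flat_exp 0 (1 : R) by rewrite /flat_exp ltr01 expr0 mul1r expR_gt0.
by rewrite {1}/flat_exp H expr0 mul1r expR_gt0.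
Qed.

Context {n : nat}.

(** The class C^k statement is proved for all j simultaneously, since the
    derivative of one member involves the next two. *)
Lemma smooth_near_flat_exp j (g : 'rV[R]_n -> R) a :
  smooth_near g a -> smooth_near (flat_exp j \o g) a.
Proof.
move=> [U [oU Ua sg]]; exists U; split=> // k.
have df i x : differentiable (flat_exp i) x.
  by apply/derivable1_diffP; have [] := is_derive_flat_exp i x.
elim: k j => [|k IH] j.
  move=> b Ub; apply: continuous_comp; first exact: (sg 0%N).
  exact/differentiable_continuous/df.
have [dg sDg] := sg k.+1.
split=> [b Ub|v]; first by apply: differentiable_comp; [exact: dg|exact: df].
apply: (@class_C_eq _ _ _ _ _ (fun b => 'D_v g b * ((flat_exp j.+2 \o g) b +
   - j%:R * (flat_exp j.+1 \o g) b))) => // [b Ub|].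
  rewrite [RHS]derive_comp; [|exact: dg|exact: df].
  rewrite -[X in 'D_X _ (g b)]mulr1.
  rewrite [RHS](@derive_vectZ _ _ _ (flat_exp j) (g b) ('D_v g b) 1) //.
  by have [_ ->] := is_derive_flat_exp j (g b); rewrite mulNr.
apply: class_CM => //; first exact: sDg.
apply: class_CD => //; apply: class_CM => //; exact: class_C_cst.
Qed.

(** The plateau function is applied to the sum of the squared coordinates,
    which is smooth, unlike the norm of row vectors. *)
Lemma bump_rV (a : 'rV[R]_n) (W : set 'rV[R]_n) : nbhs a W ->
  exists chi : 'rV[R]_n -> R, exists K : set 'rV[R]_n,
  [/\ forall b, smooth_near chi b, \forall b \near a, chi b = 1,
      compact K, K `<=` W & forall b, ~ K b -> chi b = 0].
Proof.
move=> /nbhs_ballP [e /= e0 aW].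
pose s (b : 'rV[R]_n) : R := \sum_i (b 0 i + - a 0 i) * (b 0 i + - a 0 i).
have ss b : smooth_near s b.
  apply: smooth_near_sum => i; apply: smooth_nearM;
    (apply: smooth_nearD; [exact: smooth_near_coord|exact: smooth_near_cst]).
have cs : continuous s.
  by move=> b; exact/differentiable_continuous/smooth_near_differentiable.
pose r := (e / 2) ^+ 2; have r0 : 0 < r by rewrite exprn_gt0 // divr_gt0.
(* The bump is 1 for s <= r / 2 and 0 for s >= r. *)
pose K := [set b | s b <= r].
have Kb b i : K b -> `|a 0 i - b 0 i| <= e / 2.
  have e20 : 0 <= e / 2 by rewrite divr_ge0 // ltW.
  move=> Kb; rewrite -ler_sqr ?nnegrE //.
  rewrite real_normK ?num_real //; apply: le_trans (Kb : s b <= r).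
  rewrite /s (bigD1 i) //= -sqrrN opprB -expr2 lerDl.
  by apply: sumr_ge0 => j _; rewrite -expr2 sqr_ge0.
have KB : K `<=` ball a e.
  move=> b /Kb H; rewrite -ball_normE /ball_ /=.
  apply: (@le_lt_trans _ _ (e / 2)); last lra.
  rewrite [leLHS]/Num.Def.normr /= mx_normrE;
    apply: bigmax_le; first by rewrite divr_ge0 // ltW.
  by move=> [i j] _; rewrite !mxE ord1; exact: H.
exists (fun b => (plateau 0)^-1 * plateau (2 / r * s b + - 1)), K; split.
- move=> b; apply: smooth_nearM; first exact: smooth_near_cst.
  apply: (@smooth_near_flat_exp 0%N (fun b => flat_exp 0 1 - flat_exp 0 (2 / r * s b + - 1))).
  apply: smooth_nearD; first exact: smooth_near_cst.
  rewrite (_ : (fun b => _) = (fun b => -1 * (flat_exp 0%N \o (fun b => 2 / r * s b +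
    - 1)) b)); last first.
    by apply/funext => b'; rewrite mulN1r.
  apply: smooth_nearM; first exact: smooth_near_cst.
  apply: smooth_near_flat_exp; apply: smooth_nearD; last exact: smooth_near_cst.
  by apply: smooth_nearM => //; exact: smooth_near_cst.
- have sa : s a = 0 by rewrite /s big1 // => i _; rewrite subrr mulr0.
  have : \forall b \near a, s b < r / 2.
    have /cvgrPdist_lt /(_ (r / 2)) := cs a; rewrite sa => H.
    have /H : 0 < r / 2 by lra.
    by apply: filterS => b; rewrite sub0r normrN; apply: le_lt_trans; exact: ler_norm.
  apply: filterS => b sb; rewrite plateau_le0 ?mulVf ?gt_eqF ?plateau0_gt0 //.
  rewrite subr_le0 mulrAC ler_pdivrMr // mul1r; lra.
- apply: bounded_closed_compact.
    exists (`|a| + e); split; first by rewrite num_real.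
    move=> M aM b /KB; rewrite -ball_normE /ball_ /= => ab.
    rewrite -(subrK a b); apply: le_trans (ler_normD _ _) _.
    by rewrite distrC; lra.
  rewrite (_ : K = s @^-1` [set x | x <= r]) //.
  by apply: closed_comp; [move=> b _; exact: cs|exact: closed_le].
- by move=> b /KB /aW.
- move=> b /negP; rewrite /K /= -ltNge => rs.
  rewrite [plateau (_ + _)]plateau_ge1 ?mulr0 //.
  suff : 2 <= 2 / r * s b by lra.
  rewrite mulrAC ler_pdivlMr //; lra.
Qed.

End Flat.

(** * Smooth functions and tangent vectors in charts *)

Arguments open_dom {R n T} c.
Arguments open_coord_dom {R n T} c.

Section ManifoldCalculus.
Context {R : realType} {n : nat} {M : manifold R n}.
Implicit Types (c : chart R n M) (p q : M) (V W : normedModType R).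

Lemma open_coord_image c (W : set M) : open W -> open (coord c @` (W `&` dom c)).
Proof.
move=> oW; rewrite (_ : _ @` _ = (coord c @` dom c) `&` param c @^-1` W).
  apply: open_preimage_in => //; first exact: open_coord_dom.
  by move=> a [q dq <-]; exact: param_continuous.
apply/seteqP; split=> [a [q [Wq dq] <-]|a [[q dq <-]]] /=.
  by split; [exists q|rewrite /preimage /= coordK].
by rewrite coordK // => Wq; exists q.
Qed.

Arguments open_coord_image c {W}.

Lemma near_param c p (P : set M) : dom c p -> nbhs p P ->
  \forall a \near coord c p,
    [/\ dom c (param c a), coord c (param c a) = a & P (param c a)].
Proof.
move=> dp; rewrite nbhsE => -[W [oW Wp] WP].
have oU := open_coord_image c oW.
have Ua : (coord c @` (W `&` dom c)) (coord c p) by exists p.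
apply: filterS (open_nbhs_nbhs (conj oU Ua)) => _ [q [Wq dq] <-].
by rewrite !coordK //; split=> //; exact: WP.
Qed.

Lemma near_coord c p (P : set 'rV[R]_n) : dom c p -> nbhs (coord c p) P ->
  \forall q \near p, dom c q /\ P (coord c q).
Proof.
move=> dp HP; have := coord_continuous dp HP; move: (open_nbhs_nbhs (conj (open_dom c) dp)).
by apply: filterS2.
Qed.

Lemma near_dom c p : dom c p -> \forall q \near p, dom c q.
Proof. by move=> dp; exact: open_nbhs_nbhs (conj (open_dom c) dp). Qed.

(** The compatibility of the atlas, at one point. *)
Lemma smooth_near_transition c c' p : atlas c -> atlas c' -> dom c p -> dom c' p ->
  smooth_near (coord c' \o param c) (coord c p).
Proof.
move=> ac ac' dp dp'; exists (coord c @` (dom c' `&` dom c)); split.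
- exact/open_coord_image/open_dom.
- by exists p.
- by rewrite setIC; exact: atlas_smooth.
Qed.

Lemma near_transition V c c' p (f : M -> V) : dom c p -> dom c' p ->
  {near coord c p, (f \o param c') \o (coord c' \o param c) =1 f \o param c}.
Proof.
move=> dp dp'; have := near_param dp (near_dom dp').
by apply: filterS => a [d1 E d2] /=; rewrite coordK.
Qed.

Lemma chart_atP p : atlas (chart_at p) /\ dom (chart_at p) p.
Proof. by rewrite /chart_at; case: (cid2 _). Qed.

Lemma atlas_chart_at p : atlas (chart_at p).
Proof. by case: (chart_atP p). Qed.

Lemma dom_chart_at p : dom (chart_at p) p.
Proof. by case: (chart_atP p). Qed.

#[local] Hint Resolve atlas_chart_at dom_chart_at : core.

(** Any chart around p may be used, by smooth_at_chart. *)
Definition smooth_at (f : M -> R) p :=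
  exists c, [/\ atlas c, dom c p & smooth_near (f \o param c) (coord c p)].

(** Transition maps are smooth, so smoothness in one chart passes to every
    other. *)
Lemma smooth_at_chart c p (f : M -> R) : atlas c -> dom c p ->
  smooth_at f p -> smooth_near (f \o param c) (coord c p).
Proof.
move=> ac dp [c' [ac' dp' sf]].
apply: smooth_near_eq (near_transition f dp dp') _.
apply: smooth_near_comp; first exact: smooth_near_transition.
by rewrite /= coordK.
Qed.

Lemma smooth_at_near p (f : M -> R) :
  smooth_at f p -> \forall q \near p, smooth_at f q.
Proof.
move=> [c [ac dp /smooth_near_near sf]].
by apply: filterS (near_coord dp sf) => q [dq sq]; exists c.
Qed.

Lemma smooth_at_eq p (f g : M -> R) :
  {near p, f =1 g} -> smooth_at f p -> smooth_at g p.
Proof.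
move=> fg [c [ac dp sf]]; exists c; split=> //; apply: smooth_near_eq sf.
by apply: filterS (near_param dp fg) => a [].
Qed.

Lemma smooth_at_cst (k : R) p : smooth_at (fun=> k) p.
Proof. by exists (chart_at p); split=> //; exact: smooth_near_cst. Qed.

Lemma smooth_atD p (f g : M -> R) :
  smooth_at f p -> smooth_at g p -> smooth_at (fun q => f q + g q) p.
Proof.
move=> sf sg; exists (chart_at p); split=> //.
by apply: (@smooth_nearD _ _ _ (f \o _) (g \o _)); exact: smooth_at_chart.
Qed.

Lemma smooth_atM p (f g : M -> R) :
  smooth_at f p -> smooth_at g p -> smooth_at (fun q => f q * g q) p.
Proof.
move=> sf sg; exists (chart_at p); split=> //.
by apply: (@smooth_nearM _ _ (f \o _) (g \o _)); exact: smooth_at_chart.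
Qed.

Lemma smooth_atZ p (k : R) (f : M -> R) :
  smooth_at f p -> smooth_at (fun q => k * f q) p.
Proof. by apply: smooth_atM; exact: smooth_at_cst. Qed.

Lemma smooth_atN p (f : M -> R) : smooth_at f p -> smooth_at (fun q => - f q) p.
Proof.
by move=> /(smooth_atZ (-1)); under eq_fun do rewrite mulN1r.
Qed.

Lemma smooth_atB p (f g : M -> R) :
  smooth_at f p -> smooth_at g p -> smooth_at (fun q => f q - g q) p.
Proof. by move=> sf /smooth_atN; exact: smooth_atD. Qed.

Lemma smooth_at_sum p (I : Type) (r : seq I) (f : I -> M -> R) :
  (forall i, smooth_at (f i) p) -> smooth_at (fun q => \sum_(i <- r) f i q) p.
Proof.
move=> H; elim: r => [|i r IH].
  by under eq_fun do rewrite big_nil; exact: smooth_at_cst.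
by under eq_fun do rewrite big_cons; exact: smooth_atD.
Qed.

Lemma smooth_at_coord c p (g : 'rV[R]_n -> R) : atlas c -> dom c p ->
  smooth_near g (coord c p) -> smooth_at (g \o coord c) p.
Proof.
move=> ac dp sg; exists c; split=> //; apply: smooth_near_eq sg.
have := near_param dp (near_dom dp); apply: filterS => a [_ + _] /=.
by move=> ->.
Qed.

Lemma smooth_on_at (W : set M) (f : M -> R) : open W ->
  smooth_on W f <-> forall p, W p -> smooth_at f p.
Proof.
move=> oW; split=> [sf p Wp|sf c ac].
  exists (chart_at p); split=> //.
  have := sf _ (atlas_chart_at p).
  by move/(smooth_in_near _ (open_coord_image _ oW)); apply; exists p.
apply/smooth_in_near; first exact: open_coord_image.
by move=> _ [q [Wq dq] <-]; apply: smooth_at_chart => //; exact: sf.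
Qed.

Lemma smooth_on_rV m (W : set M) (F : M -> 'rV[R]_m) : open W ->
  smooth_on W F <-> forall j p, W p -> smooth_at (fun q => F q 0 j) p.
Proof.
move=> oW; transitivity (forall j, smooth_on W (fun q => F q 0 j)); last first.
  by split=> H j; [apply/smooth_on_at|apply/smooth_on_at => //; exact: H].
split=> [H j c ac k|H c ac k].
  have [+ _] := class_C_rV k (F \o param c) (open_coord_image c oW).
  by move=> /(_ (H c ac k)) /(_ j).
by apply/class_C_rV => [|j]; [exact: open_coord_image|exact: H].
Qed.

Lemma smooth_at_differentiable p (f : M -> R) : smooth_at f p ->
  differentiable (f \o param (chart_at p)) (coord (chart_at p) p).
Proof.
by move=> sf; apply: smooth_near_differentiable; exact: smooth_at_chart.
Qed.

Lemma smooth_fun_at (f : M -> R) : smooth_fun f <-> forall p, smooth_at f p.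
Proof.
have H := smooth_on_at f (@openT M).
by split=> [/H sf p|sf]; [exact: sf|apply/H].
Qed.

(** The derivative along v is defined in the preferred chart at p; by the
    chain rule any chart computes it, through the components of v there. *)
Lemma deriv_along_chart V c p (v : tangent p) (f : M -> V) : atlas c -> dom c p ->
  differentiable (f \o param c) (coord c p) ->
  deriv_along v f = 'D_(deriv_along v (coord c)) (f \o param c) (coord c p).
Proof.
move=> ac dp df; have d0 := dom_chart_at p.
have dT := smooth_near_differentiable
  (smooth_near_transition (atlas_chart_at p) ac d0 dp).
have E : (coord c \o param (chart_at p)) (coord (chart_at p) p) = coord c p.
  by rewrite /= coordK.
rewrite [in LHS]/deriv_along -(near_eq_derive _ (near_transition f d0 dp)).
by rewrite derive_comp ?E.
Qed.

Lemma deriv_along_id p (v : tangent p) :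
  deriv_along v (coord (chart_at p)) = v.
Proof.
apply: etrans _ (@derive_id R 'rV[R]_n (coord (chart_at p) p) v).
apply: near_eq_derive.
have d0 := dom_chart_at p; have := near_param d0 (near_dom d0).
by apply: filterS => a [].
Qed.

Lemma deriv_along_near V p (v : tangent p) (f g : M -> V) :
  {near p, f =1 g} -> deriv_along v f = deriv_along v g.
Proof.
move=> fg; apply: near_eq_derive.
by have := near_param (dom_chart_at p) fg; apply: filterS => a [].
Qed.

Lemma deriv_along_cst p (v : tangent p) (k : R) : deriv_along v (fun=> k : R) = 0.
Proof. exact: derive_cst. Qed.

Lemma deriv_alongD p (v : tangent p) (f g : M -> R) :
  smooth_at f p -> smooth_at g p ->
  deriv_along v (fun q => f q + g q) = deriv_along v f + deriv_along v g.
Proof.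
move=> /smooth_at_differentiable df /smooth_at_differentiable dg.
by rewrite /deriv_along -deriveD //; exact: diff_derivable.
Qed.

Lemma deriv_alongM p (v : tangent p) (f g : M -> R) :
  smooth_at f p -> smooth_at g p ->
  deriv_along v (fun q => f q * g q) =
  f p * deriv_along v g + g p * deriv_along v f.
Proof.
move=> /smooth_at_differentiable df /smooth_at_differentiable dg.
rewrite /deriv_along.
have -> : (fun q => f q * g q) \o param (chart_at p) =
  (f \o param (chart_at p)) * (g \o param (chart_at p)) by [].
rewrite deriveM; [|exact: diff_derivable|exact: diff_derivable].
by rewrite /= !coordK.
Qed.

Lemma deriv_alongZ p (v : tangent p) (k : R) (f : M -> R) : smooth_at f p ->
  deriv_along v (fun q => k * f q) = k * deriv_along v f.
Proof.
move=> sf; rewrite deriv_alongM //; last exact: smooth_at_cst.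
by rewrite deriv_along_cst mulr0 addr0.
Qed.

Lemma deriv_alongN p (v : tangent p) (f : M -> R) : smooth_at f p ->
  deriv_along v (fun q => - f q) = - deriv_along v f.
Proof.
move=> sf; under eq_fun do rewrite -mulN1r.
by rewrite deriv_alongZ // mulN1r.
Qed.

Lemma deriv_alongB p (v : tangent p) (f g : M -> R) :
  smooth_at f p -> smooth_at g p ->
  deriv_along v (fun q => f q - g q) = deriv_along v f - deriv_along v g.
Proof. by move=> sf sg; rewrite deriv_alongD ?deriv_alongN //; exact: smooth_atN. Qed.

Lemma deriv_along_sum p (v : tangent p) (I : Type) (r : seq I) (f : I -> M -> R) :
  (forall i, smooth_at (f i) p) ->
  deriv_along v (fun q => \sum_(i <- r) f i q) = \sum_(i <- r) deriv_along v (f i).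
Proof.
move=> H; elim: r => [|i r IH].
  by under eq_fun do rewrite big_nil; rewrite big_nil deriv_along_cst.
under eq_fun do rewrite big_cons.
by rewrite big_cons deriv_alongD ?IH //; exact: smooth_at_sum.
Qed.

Lemma deriv_along_linear V p (f : M -> V) :
  differentiable (f \o param (chart_at p)) (coord (chart_at p) p) ->
  linear (fun v : tangent p => deriv_along v f).
Proof. by move=> df k u v; exact: (derive_linear df k u v). Qed.

(** The differential, the Lie derivative and the trivializations are the
    linfun of functions whose linearity is a matter of proof. *)
Lemma linfun_linear (U W : vectType R) (f : U -> W) : linear f ->
  forall u, linfun f u = f u.
Proof.
move=> lf u.
pose g : {linear U -> W} := HB.pack f (GRing.isLinear.Build _ _ _ _ _ lf).
exact: (lfunE g u).
Qed.

Local Notation TM := (tangent_bundle M).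
Implicit Types i j : triv_index TM.

Lemma tangent_trivE i p (v : tangent p) : dom (sval i) p ->
  triv i p v = deriv_along v (coord (sval i)).
Proof.
move=> dp; apply: (@linfun_linear (tangent p) 'rV[R]_n
   (fun v : tangent p => deriv_along v (coord (sval i)))).
apply: deriv_along_linear; apply: smooth_near_differentiable.
by apply: smooth_near_transition => //; exact: svalP i.
Qed.

Lemma deriv_along_triv i p (v : tangent p) (f : M -> R) : dom (sval i) p ->
  smooth_at f p ->
  deriv_along v f = 'D_(triv i p v : 'rV[R]_n) (f \o param (sval i)) (coord (sval i) p).
Proof.
move=> dp sf; rewrite tangent_trivE // -deriv_along_chart //.
  exact: (svalP i).
by apply: smooth_near_differentiable; apply: smooth_at_chart => //; exact: (svalP i).
Qed.

(** The tangent vector at p with components w in the chart i, as the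
    derivative of the transition map to the preferred chart. It is the
    inverse of the trivialization. *)
Definition tangent_of i p (w : 'rV[R]_n) : tangent p :=
  'D_w (coord (chart_at p) \o param (sval i)) (coord (sval i) p).

Lemma triv_tangent_of i j p w : dom (sval i) p -> dom (sval j) p ->
  triv j p (tangent_of i p w) =
  'D_w (coord (sval j) \o param (sval i)) (coord (sval i) p).
Proof.
move=> dp dp'; rewrite tangent_trivE // /tangent_of.
have ai := svalP i; have aj := svalP j; have d0 := dom_chart_at p.
have a0 := atlas_chart_at p.
rewrite -[RHS](near_eq_derive _ (near_transition _ dp d0)).
have E : (coord (chart_at p) \o param (sval i)) (coord (sval i) p)
   = coord (chart_at p) p by rewrite /= coordK.
rewrite derive_comp ?E //; apply: smooth_near_differentiable;
  exact: smooth_near_transition.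
Qed.

Lemma tangent_ofK i p w : dom (sval i) p -> triv i p (tangent_of i p w) = w.
Proof.
move=> dp; rewrite triv_tangent_of //.
apply: etrans _ (@derive_id R 'rV[R]_n (coord (sval i) p) w).
apply: near_eq_derive; have := near_param dp (near_dom dp).
by apply: filterS => a [].
Qed.

Lemma tangent_triv_inj i p : dom (sval i) p -> injective (triv i p).
Proof.
move=> dp; apply/lker0P; apply/eqP; apply/vspaceP => v; rewrite memv_ker memv0.
apply/eqP/eqP => [v0|->]; last by rewrite linear0.
have ai := svalP i; have d0 := dom_chart_at p; have a0 := atlas_chart_at p.
have dT := smooth_near_differentiable (smooth_near_transition ai a0 dp d0).
apply: etrans (esym (@deriv_along_id p v)) _.
by rewrite (deriv_along_chart _ ai dp dT) -tangent_trivE // v0 derive0.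
Qed.

Lemma tangent_frameE i p w : dom (sval i) p -> frame i p w = tangent_of i p w.
Proof.
move=> dp; rewrite -{1}(tangent_ofK w dp); apply: lker0_lfunK.
exact/lker0P/tangent_triv_inj.
Qed.

Lemma tangent_frameK i p w : dom (sval i) p -> triv i p (frame i p w) = w.
Proof. by move=> dp; rewrite tangent_frameE // tangent_ofK. Qed.

Lemma tangent_trivK i p (v : tangent p) : dom (sval i) p -> frame i p (triv i p v) = v.
Proof. by move=> dp; apply: lker0_lfunK; exact/lker0P/tangent_triv_inj. Qed.

(** In two charts, the components of a coordinate field are partial
    derivatives of the transition map. *)
Lemma smooth_at_triv_frame i j p w k : dom (sval i) p -> dom (sval j) p ->
  smooth_at (fun q => triv j q (frame i q w) 0 k : R) p.
Proof.
move=> dp dp'; have ai := svalP i; have aj := svalP j.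
have sT := smooth_near_transition ai aj dp dp'.
have [+ _] := smooth_near_rV ('D_w (coord (sval j) \o param (sval i))) (coord (sval i) p).
move=> /(_ (smooth_near_derive w sT)) /(_ k) /(smooth_at_coord ai dp).
apply: smooth_at_eq; near=> q.
rewrite tangent_frameE; last by near: q; exact: near_dom.
by rewrite triv_tangent_of //=; near: q; exact: near_dom.
Unshelve. all: by end_near. Qed.

Definition chart_index p : triv_index TM := exist _ (chart_at p) (atlas_chart_at p).

Lemma smooth_vfieldP (x : vfield M) : smooth_vfield x <->
  forall i k p, dom (sval i) p -> smooth_at (fun q => triv i q (x q) 0 k : R) p.
Proof.
split=> H i; have Hi := smooth_on_rV (fun q => triv i q (x q)) (open_dom (sval i)).
  by move: (H i) => /Hi.
by apply/Hi; exact: H.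
Qed.

End ManifoldCalculus.

#[local] Hint Resolve atlas_chart_at dom_chart_at : core.

(** * Dual and sum bundles *)

Section Bundles.
Context {R : realType} {n : nat} {M : manifold R n}.
Implicit Types (E F : bundle M) (p q : M).

Lemma bundle_trivK E (i : triv_index E) p (v : fiber E p) : vector_bundle E ->
  triv_dom i p -> frame i p (triv i p v) = v.
Proof.
move=> vE dp; apply: lker0_lfunK; apply/lker0P.
by have /bij_inj := triv_bij vE dp.
Qed.

Lemma bundle_frameK E (i : triv_index E) p w : vector_bundle E ->
  triv_dom i p -> triv i p (frame i p w) = w.
Proof.
move=> vE dp; have [g gK Kg] := triv_bij vE dp.
by rewrite -{1}(Kg w) bundle_trivK // Kg.
Qed.

Lemma smooth_sectionP E (s : section E) : vector_bundle E -> smooth_section s <->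
  forall (i : triv_index E) k p, triv_dom i p -> smooth_at (fun q => triv i q (s q) 0 k : R) p.
Proof.
move=> vE; split=> H i; have Hi := smooth_on_rV (fun q => triv i q (s q)) (triv_open vE i).
  by move: (H i) => /Hi.
by apply/Hi; exact: H.
Qed.

Lemma smooth_triv_frame E (i j : triv_index E) w k p : vector_bundle E ->
  triv_dom i p -> triv_dom j p -> smooth_at (fun q => triv j q (frame i q w) 0 k : R) p.
Proof.
move=> vE di dj; have oij := openI (triv_open vE i) (triv_open vE j).
have [+ _] := smooth_on_rV (fun q => triv j q (frame i q w)) oij.
by move=> /(_ (triv_smooth vE i j w)) /(_ k p); apply.
Qed.

Lemma tangent_vector_bundle : vector_bundle (tangent_bundle M).
Proof.
split=> [i|p|i p dp|i j w].
- exact: open_dom.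
- by exists (chart_index p); exact: dom_chart_at.
- exists (frame i p) => [v|w]; [exact: tangent_trivK|exact: tangent_frameK].
- apply/smooth_on_rV; first by apply: openI; exact: open_dom.
  by move=> k p [di dj]; exact: smooth_at_triv_frame.
Qed.

Lemma dual_trivE E (i : triv_index E) p (xi : 'Hom(fiber E p, R^o)) k :
  (@triv _ _ _ (dual_bundle E) i p xi) 0 k = xi (frame i p 'e_k) :> R.
Proof.
rewrite (@linfun_linear _ 'Hom(fiber E p, R^o) 'rV[R]_(rank E)
   (fun xi : 'Hom(fiber E p, R^o) => \row_k (xi (frame i p (delta_mx 0 k)) : R))) ?mxE //.
by move=> l u v; apply/rowP => k'; rewrite !mxE add_lfunE scale_lfunE.
Qed.

(** The inverse of the dual trivialization. *)
Definition dual_frame E (i : triv_index E) p (w : 'rV[R]_(rank E)) : 'Hom(fiber E p, R^o) :=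
  linfun (fun v : fiber E p => \sum_k w 0 k * triv i p v 0 k : R^o).

Lemma dual_frameE E (i : triv_index E) p w (v : fiber E p) :
  dual_frame i p w v = \sum_k w 0 k * triv i p v 0 k :> R.
Proof.
apply: (@linfun_linear _ (fiber E p) R^o (fun v : fiber E p => \sum_k w 0 k * triv i p v 0 k : R^o)).
move=> l u u'; rewrite scaler_sumr -big_split; apply: eq_bigr => k _.
by rewrite linearP !mxE mulrDr mulrCA.
Qed.

Lemma dual_frameK E (i : triv_index E) p w : vector_bundle E -> triv_dom i p ->
  @triv _ _ _ (dual_bundle E) i p (dual_frame i p w) = w.
Proof.
move=> vE dp; apply/rowP => k; rewrite dual_trivE dual_frameE.
rewrite bundle_frameK // (bigD1 k) //= mxE !eqxx mulr1 big1 ?addr0 // => l lk.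
by rewrite mxE eqxx (negbTE lk) mulr0.
Qed.

Lemma dual_trivK E (i : triv_index E) p (xi : 'Hom(fiber E p, R^o)) :
  vector_bundle E -> triv_dom i p ->
  dual_frame i p (@triv _ _ _ (dual_bundle E) i p xi) = xi.
Proof.
move=> vE dp; apply/lfunP => v; rewrite dual_frameE.
rewrite -[in RHS](bundle_trivK v vE dp) [in RHS](row_sum_delta (triv i p v)) !linear_sum.
by apply: eq_bigr => k _; rewrite dual_trivE !linearZ mulrC.
Qed.

Lemma frame_dualE E (i : triv_index E) p w : vector_bundle E -> triv_dom i p ->
  @frame _ _ _ (dual_bundle E) i p w = dual_frame i p w.
Proof.
move=> vE dp; rewrite -{1}(@dual_frameK E i p w vE dp); apply: lker0_lfunK.
by apply/lker0P; apply: (can_inj (g := dual_frame i p)) => xi; exact: dual_trivK.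
Qed.

Lemma dual_vector_bundle E : vector_bundle E -> vector_bundle (dual_bundle E).
Proof.
move=> vE; split=> [i|p|i p dp|i j w].
- exact: (triv_open vE).
- exact: (triv_cover vE).
- apply: (@Bijective _ _ _ (@dual_frame E i p)) => [xi|w]; [exact: dual_trivK|exact: dual_frameK].
- apply/smooth_on_rV; first by apply: openI; exact: (triv_open vE).
  move=> k p [di dj].
  apply: (@smooth_at_eq _ _ _ _ (fun q =>
    \sum_l w 0 l * @triv _ _ _ E i q (@frame _ _ _ E j q 'e_k) 0 l)).
    apply: filterS (open_nbhs_nbhs (conj (triv_open vE i) di)) => q dq.
    by rewrite dual_trivE frame_dualE //; apply: esym; exact: (@dual_frameE E i q w).
  by apply: smooth_at_sum => l; apply: smooth_atZ; exact: smooth_triv_frame.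
Qed.

Section Sum.
Variables E F : bundle M.
Hypotheses (vE : vector_bundle E) (vF : vector_bundle F).
Local Notation EF := (sum_bundle E F).

Lemma sum_trivE (ij : triv_index EF) p (u : fiber E p * fiber F p) :
  @triv _ _ _ EF ij p u = row_mx (triv ij.1 p u.1) (triv ij.2 p u.2).
Proof.
apply: (@linfun_linear _ (fiber E p * fiber F p)%type 'rV[R]_(rank E + rank F)
   (fun u : fiber E p * fiber F p => row_mx (triv ij.1 p u.1) (triv ij.2 p u.2))).
by move=> l v w; rewrite !linearP scale_row_mx add_row_mx.
Qed.

Lemma sum_triv_lshift (ij : triv_index EF) p (u : fiber E p * fiber F p) k :
  @triv _ _ _ EF ij p u 0 (lshift _ k) = triv ij.1 p u.1 0 k.
Proof. by rewrite sum_trivE row_mxEl. Qed.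

Lemma sum_triv_rshift (ij : triv_index EF) p (u : fiber E p * fiber F p) k :
  @triv _ _ _ EF ij p u 0 (rshift _ k) = triv ij.2 p u.2 0 k.
Proof. by rewrite sum_trivE row_mxEr. Qed.

Definition sum_frame (ij : triv_index EF) p (w : 'rV[R]_(rank E + rank F)) :
    fiber E p * fiber F p := (frame ij.1 p (lsubmx w), frame ij.2 p (rsubmx w)).

Lemma sum_frameK (ij : triv_index EF) p w : triv_dom ij p ->
  @triv _ _ _ EF ij p (sum_frame ij p w) = w.
Proof.
by move=> [d1 d2]; rewrite sum_trivE /= !bundle_frameK // hsubmxK.
Qed.

Lemma sum_trivK (ij : triv_index EF) p (u : fiber E p * fiber F p) : triv_dom ij p ->
  sum_frame ij p (@triv _ _ _ EF ij p u) = u.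
Proof.
move=> [d1 d2]; rewrite sum_trivE /sum_frame row_mxKl row_mxKr !bundle_trivK //.
by case: u.
Qed.

Lemma frame_sumE (ij : triv_index EF) p w : triv_dom ij p ->
  @frame _ _ _ EF ij p w = sum_frame ij p w.
Proof.
move=> dp; rewrite -{1}(sum_frameK w dp); apply: lker0_lfunK.
by apply/lker0P; apply: (can_inj (g := sum_frame ij p)) => u; exact: sum_trivK.
Qed.

Lemma open_sum_dom (ij : triv_index EF) : open (triv_dom ij).
Proof. by apply: openI; [exact: (triv_open vE)|exact: (triv_open vF)]. Qed.

Lemma near_sum_dom (ij : triv_index EF) p : triv_dom ij p ->
  \forall q \near p, triv_dom ij q.
Proof. by move=> dp; exact: open_nbhs_nbhs (conj (open_sum_dom ij) dp). Qed.

Lemma sum_vector_bundle : vector_bundle EF.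
Proof.
split=> [ij|p|ij p dp|ij kl w].
- exact: open_sum_dom.
- have [i di] := triv_cover vE p; have [j dj] := triv_cover vF p.
  by exists (i, j).
- apply: (@Bijective _ _ _ (sum_frame ij p)) => [u|w]; [exact: sum_trivK|exact: sum_frameK].
- apply/smooth_on_rV; first by apply: openI; exact: open_sum_dom.
  move=> k p [dij dkl]; case: (dij) (dkl) => d1 d2 [d3 d4].
  have frameE := near_sum_dom dij.
  case: (splitP k) => [k' kk'|k' kk'].
    have -> : k = lshift (rank F) k' by exact/val_inj.
    apply: (@smooth_at_eq _ _ _ _ (fun q => triv kl.1 q (frame ij.1 q (lsubmx w)) 0 k')).
      by apply: filterS frameE => q dq; rewrite frame_sumE // sum_triv_lshift.
    exact: smooth_triv_frame.
  have -> : k = rshift (rank E) k' by exact/val_inj.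
  apply: (@smooth_at_eq _ _ _ _ (fun q => triv kl.2 q (frame ij.2 q (rsubmx w)) 0 k')).
    by apply: filterS frameE => q dq; rewrite frame_sumE // sum_triv_rshift.
  exact: smooth_triv_frame.
Qed.

Lemma smooth_sum_section (s : section EF) : smooth_section s <->
  @smooth_section _ _ _ E (fun p => (s p).1) /\ @smooth_section _ _ _ F (fun p => (s p).2).
Proof.
split.
  move=> /(smooth_sectionP _ sum_vector_bundle) H.
  split; apply/smooth_sectionP => // i k p di.
    have [j dj] := triv_cover vF p.
    have := H (i, j) (lshift _ k) p (conj di dj).
    by under eq_fun do rewrite sum_triv_lshift.
  have [j dj] := triv_cover vE p.
  have := H (j, i) (rshift _ k) p (conj dj di).
  by under eq_fun do rewrite sum_triv_rshift.
move=> [/(smooth_sectionP _ vE) H1 /(smooth_sectionP _ vF) H2].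
apply/(smooth_sectionP _ sum_vector_bundle) => ij k p [d1 d2].
case: (splitP k) => [k' kk'|k' kk'].
  have -> : k = lshift (rank F) k' by exact/val_inj.
  by under eq_fun do rewrite sum_triv_lshift; exact: H1.
have -> : k = rshift (rank E) k' by exact/val_inj.
by under eq_fun do rewrite sum_triv_rshift; exact: H2.
Qed.

End Sum.

End Bundles.

(** * Vector fields and 1-forms *)

Section VectorFields.
Context {R : realType} {n : nat} {M : manifold R n}.
Implicit Types (c : chart R n M) (p q : M) (x y z : vfield M) (eta : form1 M).
Local Notation TM := (tangent_bundle M).
Implicit Types i j : triv_index TM.

Lemma triv_chart_index p (v : tangent p) : triv (chart_index p) p v = v.
Proof. by rewrite tangent_trivE ?deriv_along_id //=. Qed.

Lemma frame_chart_index p (w : 'rV[R]_n) : frame (chart_index p) p w = w.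
Proof. by rewrite -{2}(tangent_frameK (i := chart_index p) w (dom_chart_at p)) triv_chart_index. Qed.

Lemma act_chart i x (f : M -> R) q : dom (sval i) q -> smooth_at f q ->
  act x f q = \sum_k triv i q (x q) 0 k *
     'D_('e_k) (f \o param (sval i)) (coord (sval i) q).
Proof.
move=> dq sf; rewrite /act (deriv_along_triv _ dq sf) derive_sum_coord //.
by apply: smooth_near_differentiable; apply: smooth_at_chart => //; exact: (svalP i).
Qed.

Lemma smooth_at_partial i (f : M -> R) (v : 'rV[R]_n) p : dom (sval i) p -> smooth_at f p ->
  smooth_at (fun q => 'D_v (f \o param (sval i)) (coord (sval i) q)) p.
Proof.
move=> dp sf; apply: (@smooth_at_coord _ _ _ (sval i) p ('D_v (f \o param (sval i)))) => //.
  exact: (svalP i).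
by apply: smooth_near_derive; apply: smooth_at_chart => //; exact: (svalP i).
Qed.

Lemma smooth_at_act x (f : M -> R) p : smooth_vfield x -> smooth_at f p ->
  smooth_at (act x f) p.
Proof.
move=> /smooth_vfieldP sx sf; pose i := chart_index p.
apply: (@smooth_at_eq _ _ _ _ (fun q => \sum_k triv i q (x q) 0 k *
     'D_('e_k) (f \o param (sval i)) (coord (sval i) q))).
  near=> q; rewrite -act_chart //; first by near: q; exact/near_dom/dom_chart_at.
  by near: q; exact: smooth_at_near.
apply: smooth_at_sum => k; apply: smooth_atM.
  by apply: sx; exact: dom_chart_at.
by apply: smooth_at_partial => //; exact: dom_chart_at.
Unshelve. all: by end_near. Qed.

Lemma actD x (f g : M -> R) p : smooth_at f p -> smooth_at g p ->
  act x (fun q => f q + g q) p = act x f p + act x g p.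
Proof. exact: deriv_alongD. Qed.

Lemma actB x (f g : M -> R) p : smooth_at f p -> smooth_at g p ->
  act x (fun q => f q - g q) p = act x f p - act x g p.
Proof. exact: deriv_alongB. Qed.

Lemma actZ x (k : R) (f : M -> R) p : smooth_at f p ->
  act x (fun q => k * f q) p = k * act x f p.
Proof. exact: deriv_alongZ. Qed.

Lemma deriv_along_vectB p (u v : tangent p) (f : M -> R) : smooth_at f p ->
  deriv_along (u - v) f = deriv_along u f - deriv_along v f.
Proof.
move=> /smooth_at_differentiable df.
have L := deriv_along_linear df.
by rewrite addrC -scaleN1r L scaleN1r addrC.
Qed.

Lemma act_fieldB x y (f : M -> R) p : smooth_at f p ->
  act (fun q => x q - y q) f p = act x f p - act y f p.
Proof. exact: deriv_along_vectB. Qed.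

Lemma near_vlocal p x : \forall q \near p, vlocal p x q = triv (chart_index p) q (x q).
Proof.
have := near_dom (dom_chart_at p); apply: filterS => q dq.
by rewrite tangent_trivE.
Qed.

Lemma smooth_at_vlocal p x k : smooth_vfield x ->
  smooth_at (fun q => vlocal p x q 0 k : R) p.
Proof.
move=> /smooth_vfieldP /(_ (chart_index p) k p (dom_chart_at p)).
apply: smooth_at_eq; have := near_vlocal p x.
by apply: filterS => q ->.
Qed.

Lemma differentiable_vlocal p x : smooth_vfield x ->
  differentiable (vlocal p x \o param (chart_at p)) (coord (chart_at p) p).
Proof.
move=> sx; apply: differentiable_rV => j.
exact: (smooth_at_differentiable (smooth_at_vlocal p j sx)).
Qed.

Lemma deriv_along_entry p (v : tangent p) x k : smooth_vfield x ->
  (deriv_along v (vlocal p x)) 0 k = deriv_along v (fun q => vlocal p x q 0 k : R).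
Proof. by move=> /(@differentiable_vlocal p) dx; rewrite /deriv_along derive_entry. Qed.

Lemma vlocal_at p x : vlocal p x p = x p.
Proof. exact: deriv_along_id. Qed.

(** In the chart at p the first order terms of x(yf) - y(xf) are those of
    the bracket and the second order terms cancel by schwarz. *)
Lemma act_bracket x y (f : M -> R) p :
  smooth_vfield x -> smooth_vfield y -> smooth_at f p ->
  act (lie_bracket x y) f p = act x (act y f) p - act y (act x f) p.
Proof.
move=> sx sy sf; pose i := chart_index p; pose c := chart_at p; pose a := coord c p.
pose F := f \o param c.
have dp := dom_chart_at p.
have sF : smooth_near F a by exact: smooth_at_chart (atlas_chart_at p) dp sf.
have dF := smooth_near_differentiable sF.
pose G k q := 'D_('e_k) F (coord c q).
have sG k : smooth_at (G k) p by exact: (@smooth_at_partial i).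
have dG (u : 'rV[R]_n) : deriv_along (u : tangent p) f = 'D_u F a by [].
(* The partial derivatives of f in the chart, differentiated once more. *)
have DG (u : 'rV[R]_n) k : deriv_along (u : tangent p) (G k) = 'D_('e_k) ('D_u F) a.
  apply: etrans _ (schwarz u 'e_k sF); apply: near_eq_derive.
  by have := near_param dp (near_dom dp); apply: filterS => b [_ + _] /= => /= E; rewrite /G E.
have Hact (w : vfield M) (u : 'rV[R]_n) : smooth_vfield w ->
  deriv_along (u : tangent p) (act w f) =
    'D_(deriv_along (u : tangent p) (vlocal p w)) F a + 'D_(w p : 'rV[R]_n) ('D_u F) a.
  move=> sw.
  have E : \forall q \near p, act w f q = \sum_k vlocal p w q 0 k * G k q.
    near=> q; rewrite (@act_chart i).
    - apply: eq_bigr => k _; rewrite (_ : vlocal p w q = triv i q (w q)) //.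
      by near: q; exact: near_vlocal.
    - by near: q; exact: near_dom.
    - by near: q; exact: smooth_at_near.
  rewrite (deriv_along_near _ E) deriv_along_sum; last first.
    by move=> k; apply: smooth_atM => //; exact: smooth_at_vlocal.
  rewrite [X in _ = X + _]derive_sum_coord // [X in _ = _ + X]derive_sum_coord; last first.
    by apply: smooth_near_differentiable; exact: smooth_near_derive.
  rewrite -big_split /=; apply: eq_bigr => k _.
  rewrite deriv_alongM //; last exact: smooth_at_vlocal.
  by rewrite vlocal_at DG deriv_along_entry // addrC [G k p * _]mulrC.
apply: etrans (deriv_along_vectB _ _ sf) _; apply: esym.
rewrite [X in X - _ = _](Hact y (x p) sy) [X in _ - X = _](Hact x (y p) sx).
by rewrite [X in _ + X - _](schwarz (y p) (x p) sF) [X in _ - X]addrC addrKA.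
Unshelve. all: by end_near. Qed.

(** Multiplying a coordinate field by a bump function supported in the chart
    and extending by zero. The support is compact, hence closed because the
    manifold is Hausdorff, and the extension is zero on the open complement. *)
Lemma extend_frame i p (w : 'rV[R]_n) : dom (sval i) p ->
  exists2 z, smooth_vfield z & \forall q \near p, z q = frame i q w.
Proof.
move=> dp; pose c := sval i; have ac : atlas c := svalP i.
have [chi [K [schi chi1 cK Kc chi0]]] : exists chi : 'rV[R]_n -> R, exists K : set 'rV[R]_n,
  [/\ forall b, smooth_near chi b, \forall b \near coord c p, chi b = 1,
      compact K, K `<=` coord c @` dom c & forall b, ~ K b -> chi b = 0].
  apply: bump_rV; apply: open_nbhs_nbhs; split; first exact: open_coord_dom.
  by exists p.
pose z : vfield M := fun q =>
  (if `[<dom c q>] then chi (coord c q) *: frame i q w else 0 : tangent q).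
have zdom q : dom c q -> z q = chi (coord c q) *: frame i q w.
  by move=> dq; rewrite /z asboolT.
exists z; last first.
  have := near_coord dp chi1; apply: filterS => q [dq E].
  by rewrite zdom // E scale1r.
pose L := param c @` K.
have KL q : dom c q -> K (coord c q) -> L q.
  by move=> dq Kq; exists (coord c q); rewrite ?coordK.
have cL : closed L.
  apply: compact_closed; first exact: carrier_hausdorff.
  apply: continuous_compact => //; apply: continuous_in_subspaceT => a.
  by rewrite inE => /Kc [q dq <-]; exact: param_continuous.
apply/smooth_vfieldP => j k q dq'.
have [dq|ndq] := pselect (dom c q).
  apply: (@smooth_at_eq _ _ _ _ (fun q => chi (coord c q) * triv j q (frame i q w) 0 k)).
    have := near_dom dq; apply: filterS => q' dq2.
    by rewrite zdom // linearZ mxE.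
  apply: smooth_atM; last exact: smooth_at_triv_frame.
  exact: (@smooth_at_coord _ _ _ c q chi).
(* Outside the chart, the complement of the support is a neighbourhood. *)
have nL : ~ L q.
  by move=> [a /Kc [q' dq2 <-]]; rewrite coordK // => E; apply: ndq; rewrite -E.
apply: (@smooth_at_eq _ _ _ _ (fun=> 0)); last exact: smooth_at_cst.
have : nbhs q (~` L) by apply: open_nbhs_nbhs; split => //; exact: closed_openC.
apply: filterS => q' nLq'; rewrite /z; case: asboolP => [dq2|_]; last by rewrite linear0 mxE.
by rewrite chi0 ?scale0r ?linear0 ?mxE // => /(KL _ dq2).
Qed.

Lemma extend_tangent p (v : tangent p) : exists2 z, smooth_vfield z & z p = v.
Proof.
have [z sz E] := @extend_frame (chart_index p) p v (dom_chart_at p).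
by exists z => //; rewrite (nbhs_singleton E) frame_chart_index.
Qed.

Definition smooth_form eta := @smooth_section _ _ _ (cotangent_bundle M) eta.

Lemma covector_sum p (xi : cotangent p) (w : 'rV[R]_n) i :
  xi (frame i p w) = \sum_k w 0 k * xi (frame i p 'e_k) :> R.
Proof.
rewrite {1}(row_sum_delta w) !linear_sum; apply: eq_bigr => k _.
by rewrite !linearZ.
Qed.

Lemma smooth_formP eta : smooth_form eta <->
  forall i k p, dom (sval i) p -> smooth_at (fun q => eta q (frame i q 'e_k) : R) p.
Proof.
split=> H i; have := smooth_on_rV
  (fun q => @triv _ _ _ (cotangent_bundle M) i q (eta q)) (open_dom (sval i)).
  move=> [/(_ (H i)) Hi _] k p dp.
  by have := Hi k p dp; under eq_fun do rewrite (@dual_trivE _ _ _ TM).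
move=> [_]; apply=> k p dp.
by under eq_fun do rewrite (@dual_trivE _ _ _ TM); exact: H.
Qed.

Lemma smooth_at_covector eta i p (w : 'rV[R]_n) : smooth_form eta ->
  dom (sval i) p -> smooth_at (fun q => eta q (frame i q w) : R) p.
Proof.
move=> /smooth_formP se dp.
under eq_fun do rewrite covector_sum.
by apply: smooth_at_sum => k; apply: smooth_atZ; exact: se.
Qed.

Lemma pairing_chart eta x i q : dom (sval i) q ->
  pairing eta x q = \sum_k triv i q (x q) 0 k * eta q (frame i q 'e_k).
Proof. by move=> dq; rewrite /pairing -{1}(tangent_trivK (x q) dq) covector_sum. Qed.

Lemma smooth_pairing eta x p : smooth_form eta -> smooth_vfield x ->
  smooth_at (pairing eta x) p.
Proof.
move=> /smooth_formP se /smooth_vfieldP sx; pose i := chart_index p.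
have dp := dom_chart_at p.
apply: (@smooth_at_eq _ _ _ _ (fun q => \sum_k triv i q (x q) 0 k * eta q (frame i q 'e_k))).
  by have := near_dom dp; apply: filterS => q dq; rewrite (@pairing_chart _ _ i).
by apply: smooth_at_sum => k; apply: smooth_atM; [exact: sx|exact: se].
Qed.

(** Global fields suffice because extend_frame produces, near each point,
    the coordinate fields among them. *)
Lemma smooth_form_test eta :
  (forall z p, smooth_vfield z -> smooth_at (pairing eta z) p) -> smooth_form eta.
Proof.
move=> H; apply/smooth_formP => i k p dp.
have [z sz E] := extend_frame 'e_k dp.
apply: smooth_at_eq (H z p sz).
by apply: filterS E => q E; rewrite /pairing E.
Qed.

Lemma differentialE (f : M -> R) p (v : tangent p) : smooth_at f p ->
  differential f p v = deriv_along v f.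
Proof.
move=> /smooth_at_differentiable df; apply: linfun_linear.
exact: deriv_along_linear df.
Qed.

(** This gives access to lie_deriv, the linfun of this function. *)
Lemma lie_deriv_linear x eta p : smooth_vfield x -> smooth_form eta ->
  linear (fun v : tangent p =>
    (deriv_along (x p) (fun q => eta q (at_frame p q v) : R)
     + eta p (deriv_along v (vlocal p x)) : R^o)).
Proof.
move=> sx se k u v; have dp := dom_chart_at p.
have sm (w : tangent p) : smooth_at (fun q => eta q (at_frame p q w) : R) p.
  exact: (@smooth_at_covector eta (chart_index p) p w).
have -> : (fun q => eta q (at_frame p q (k *: u + v)) : R) =
   (fun q => k * (eta q (at_frame p q u) : R) + (eta q (at_frame p q v) : R)).
  by apply/funext => q; rewrite !linearP.
rewrite deriv_alongD ?deriv_alongZ //; last exact: smooth_atZ.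
rewrite (deriv_along_linear (differentiable_vlocal p sx)) linearP.
by rewrite scalerDr addrACA.
Qed.

(** The definition uses components in the chart at p; the derivative of the
    sum of eta_k z^k along x produces, besides the terms of the definition,
    the part x(z^k) of the bracket. *)
Lemma lie_derivE x eta z p : smooth_vfield x -> smooth_form eta -> smooth_vfield z ->
  lie_deriv x eta p (z p) =
    act x (pairing eta z) p - pairing eta (lie_bracket x z) p :> R.
Proof.
move=> sx se sz; have dp := dom_chart_at p; pose i := chart_index p.
have sek k : smooth_at (fun q => eta q (frame i q 'e_k) : R) p.
  exact: smooth_at_covector.
have -> : lie_deriv x eta p (z p) = (deriv_along (x p) (fun q => eta q (frame i q (z p)) : R)
     + eta p (deriv_along (z p) (vlocal p x)) : R^o).
  exact: (linfun_linear (lie_deriv_linear sx se)).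
have -> : act x (pairing eta z) p =
   deriv_along (x p) (fun q => eta q (frame i q (z p)) : R)
     + eta p (deriv_along (x p) (vlocal p z)).
  rewrite /act.
  have E : \forall q \near p, pairing eta z q =
    \sum_k vlocal p z q 0 k * (eta q (frame i q 'e_k) : R).
    near=> q; rewrite (@pairing_chart _ _ i); last by near: q; exact: near_dom.
    apply: eq_bigr => k _; rewrite (_ : vlocal p z q = triv i q (z q)) //.
    by near: q; exact: near_vlocal.
  rewrite (deriv_along_near _ E) deriv_along_sum; last first.
    by move=> k; apply: smooth_atM => //; exact: smooth_at_vlocal.
  have -> : (fun q => eta q (frame i q (z p)) : R) =
     (fun q => \sum_k (z p : 'rV[R]_n) 0 k * (eta q (frame i q 'e_k) : R)).
    by apply/funext => q; rewrite covector_sum.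
  rewrite deriv_along_sum; last by move=> k; exact: smooth_atZ.
  rewrite -[in X in _ = _ + X](@frame_chart_index p (deriv_along (x p) (vlocal p z))) covector_sum.
  rewrite -big_split /=; apply: eq_bigr => k _.
  rewrite deriv_alongM ?deriv_alongZ //; last exact: smooth_at_vlocal.
  by rewrite vlocal_at deriv_along_entry // (mulrC (eta p _)).
by rewrite /pairing /lie_bracket linearB opprB addrACA subrr addr0.
Unshelve. all: by end_near. Qed.

End VectorFields.

Section VectorFieldOps.
Context {R : realType} {n : nat} {M : manifold R n}.
Implicit Types (p q : M) (x y z : vfield M) (eta xi : form1 M).

Lemma pairingB eta x y : pairing eta (fun q => x q - y q) =
  (fun q => pairing eta x q - pairing eta y q).
Proof. by apply/funext => q; rewrite /pairing linearB. Qed.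

Lemma act_field_lin (k : R) x y (f : M -> R) p : smooth_at f p ->
  act (fun q => k *: x q + y q) f p = k * act x f p + act y f p.
Proof. by move=> /smooth_at_differentiable df; exact: (deriv_along_linear df). Qed.

Lemma smooth_form0 : smooth_form (fun p : M => 0).
Proof.
apply/smooth_formP => i k p dp; under eq_fun do rewrite lfunE.
exact: smooth_at_cst.
Qed.

Lemma act_lin z (a : R) (f g : M -> R) p : smooth_at f p -> smooth_at g p ->
  act z (fun q => a * f q + g q) p = a * act z f p + act z g p.
Proof. by move=> sf sg; rewrite actD ?actZ //; exact: smooth_atZ. Qed.

Lemma pairing_lin eta (a : R) x y :
  pairing eta (fun q => a *: x q + y q) = (fun q => a * pairing eta x q + pairing eta y q).
Proof. by apply/funext => q; rewrite /pairing linearP. Qed.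

Lemma pairing_linl (a : R) eta xi x :
  pairing (fun q => a *: eta q + xi q) x = (fun q => a * pairing eta x q + pairing xi x q).
Proof. by apply/funext => q; rewrite /pairing add_lfunE scale_lfunE. Qed.

End VectorFieldOps.

(** * Algebra of the product *)

(** Only the values at one point of functions and of their iterated
    derivatives enter the axioms. So X, A and Xi stand for fields, functions
    and 1-forms, ev for the evaluation at the point, d for the action of
    fields on functions and pr for the pairing, and the identities below are
    linear in real unknowns. *)
Section FlatCalculus.
Variables (R : realFieldType) (X A Xi : Type) (ev : A -> R) (d : X -> A -> A).
Variables (nab : X -> X -> X) (pr : Xi -> X -> A) (phi : X -> X -> X -> A).
Variable star : X -> Xi -> X -> Xi -> Xi.
Hypothesis d_comm : forall x y f,
  ev (d x (d y f)) - ev (d y (d x f)) = ev (d (nab x y) f) - ev (d (nab y x) f).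
Hypothesis nab_flat : forall xi x y z,
  ev (pr xi (nab x (nab y z))) - ev (pr xi (nab y (nab x z))) =
  ev (pr xi (nab (nab x y) z)) - ev (pr xi (nab (nab y x) z)).
Hypothesis phi_cyclic : forall x y z,
  ev (phi x y z) = ev (phi x z y) - ev (phi z x y).
Hypothesis d_phi_cyclic : forall w x y z,
  ev (d w (phi x y z)) = ev (d w (phi x z y)) - ev (d w (phi z x y)).
Hypothesis star_pr : forall x xi y eta z,
  ev (pr (star x xi y eta) z) =
  ev (d x (pr eta z)) - (ev (pr eta (nab x z)) - ev (pr eta (nab z x)))
  + ev (pr xi (nab z y)) - 2^-1 * (ev (d z (pr xi y)) + ev (d z (pr eta x)))
  + ev (phi x y z).
Hypothesis d_star_pr : forall w x xi y eta z,
  ev (d w (pr (star x xi y eta) z)) =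
  ev (d w (d x (pr eta z))) - (ev (d w (pr eta (nab x z))) - ev (d w (pr eta (nab z x))))
  + ev (d w (pr xi (nab z y)))
  - 2^-1 * (ev (d w (d z (pr xi y))) + ev (d w (d z (pr eta x))))
  + ev (d w (phi x y z)).

(** Adding the instances of phi_cyclic for the permutations of the
    arguments. *)
Lemma phi_swap x y z : ev (phi z y x) = - ev (phi x y z).
Proof.
have := phi_cyclic x y z; have := phi_cyclic x z y.
have := phi_cyclic z x y; have := phi_cyclic z y x; lra.
Qed.

Lemma d_phi_swap w x y z : ev (d w (phi z y x)) = - ev (d w (phi x y z)).
Proof.
have := d_phi_cyclic w x y z; have := d_phi_cyclic w x z y.
have := d_phi_cyclic w z x y; have := d_phi_cyclic w z y x; lra.
Qed.

(** Invariance of the form: after expansion only an instance of phi_cyclic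
    remains. *)
Lemma star_form_invariance x1 x2 x3 xi1 xi2 xi3 :
  ev (d x1 (pr xi2 x3)) - ev (d x1 (pr xi3 x2)) =
  ev (pr (star x1 xi1 x2 xi2) x3)
  - 2^-1 * (ev (d x3 (pr xi1 x2)) - ev (d x3 (pr xi2 x1)))
  - ev (pr xi3 (nab x1 x2))
  + (ev (pr xi2 (nab x1 x3)) - ev (pr xi2 (nab x3 x1))
     - (ev (pr (star x1 xi1 x3 xi3) x2) - ev (pr (star x3 xi3 x1 xi1) x2))).
Proof. have := phi_cyclic x1 x2 x3; rewrite !star_pr; lra. Qed.

(** The left side is the 1-form part of the associator axiom at z, the right
    side the coboundary of the swapped tensor at (x1, x2, z, x3). *)
Lemma star_associator_defect x1 x2 x3 z xi1 xi2 xi3 :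
  let S12 := star x1 xi1 x2 xi2 in let S21 := star x2 xi2 x1 xi1 in
  let S23 := star x2 xi2 x3 xi3 in let S13 := star x1 xi1 x3 xi3 in
  ev (pr (star x1 xi1 (nab x2 x3) S23) z) - ev (pr (star (nab x1 x2) S12 x3 xi3) z)
  - (ev (pr (star x2 xi2 (nab x1 x3) S13) z) - ev (pr (star (nab x2 x1) S21 x3 xi3) z))
  - 6^-1 * (ev (d z (pr S12 x3)) - ev (d z (pr xi3 (nab x1 x2)))
    + (ev (d z (pr xi1 (nab x2 x3))) - ev (d z (pr S23 x1)))
    - (ev (d z (pr S21 x3)) - ev (d z (pr xi3 (nab x2 x1))))
    - (ev (d z (pr xi2 (nab x1 x3))) - ev (d z (pr S13 x2))))
  = ev (d x1 (phi x2 x3 z)) - ev (d x2 (phi x1 x3 z)) + ev (d z (phi x1 x3 x2))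
  - (ev (phi x2 (nab x1 x3) z) - ev (phi x1 (nab x2 x3) z) + ev (phi x1 (nab z x3) x2))
  + (- (ev (phi (nab x1 x2) x3 z) - ev (phi (nab x2 x1) x3 z))
     + (ev (phi (nab x1 z) x3 x2) - ev (phi (nab z x1) x3 x2))
     - (ev (phi (nab x2 z) x3 x1) - ev (phi (nab z x2) x3 x1))).
Proof.
move=> /=; rewrite !(star_pr, d_star_pr).
rewrite (phi_swap x2 x3 (nab x1 z)) (phi_swap x2 x3 (nab z x1)).
rewrite (phi_swap x1 x3 (nab x2 z)) (phi_swap x1 x3 (nab z x2)).
(* Besides x1 and x2, the field z has to be moved across x1 and x2: it
   differentiates through the exact terms of the product. *)
have := d_comm x1 x2 (pr xi3 z).
have := d_comm z x1 (pr xi3 x2); have := d_comm z x2 (pr xi3 x1).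
have := d_comm z x1 (pr xi2 x3); have := d_comm z x2 (pr xi1 x3).
have := nab_flat xi3 x1 x2 z; have := nab_flat xi3 z x1 x2.
have := nab_flat xi3 z x2 x1; have := nab_flat xi2 z x1 x3.
have := nab_flat xi1 z x2 x3.
have := phi_cyclic x1 (nab z x3) x2.
have := phi_swap x1 x2 (nab z x3); have := phi_swap x2 x1 (nab z x3).
have := d_phi_cyclic z x1 x2 x3; have := d_phi_cyclic z x1 x3 x2.
have := d_phi_swap z x1 x2 x3; have := d_phi_swap z x2 x1 x3.
have := d_phi_swap z x1 x3 x2.
lra.
Qed.
End FlatCalculus.

Section ScalarIdentities.
Variable R : realFieldType.

Lemma invariance_regroup (a b c d g h k : R) :
  a - g - b + (c - d - (h - k)) = a - b - g + (c - h - (d - k)).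
Proof. ring. Qed.

Lemma subrACA (a b c d : R) : a - b - (c - d) = a - c - (b - d).
Proof. ring. Qed.

Lemma congr_tail (g a b c a' b' c' : R) : a = a' -> b = b' -> c = c' ->
  g + (- a + b - c) = g + (- a' + b' - c').
Proof. by move=> -> -> ->. Qed.

Lemma linear_congr (a u v u' v' : R) : u' = u -> v' = v -> a * u + v = a * u' + v'.
Proof. by move=> -> ->. Qed.

Lemma linear_regroup (a u1 u2 u3 u4 u5 u6 u7 v1 v2 v3 v4 v5 v6 v7 : R) :
  a * u1 + v1 - (a * u2 + v2 - (a * u3 + v3)) + (a * u4 + v4)
  - 2^-1 * (a * u5 + v5 + (a * u6 + v6)) + (a * u7 + v7) =
  a * (u1 - (u2 - u3) + u4 - 2^-1 * (u5 + u6) + u7)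
  + (v1 - (v2 - v3) + v4 - 2^-1 * (v5 + v6) + v7).
Proof. ring. Qed.

End ScalarIdentities.

(** * The canonical structure of the tangent plus cotangent bundle *)

Section Canonical.
Context {R : realType} {n : nat} {M : manifold R n}.
Implicit Types (p q : M).
Local Notation TT := (TTstar M).
Implicit Types e : section TT.

Lemma TTstar_rhoE p (u : fiber TT p) : TTstar_rho p u = u.1.
Proof.
by apply: (@linfun_linear _ (fiber TT p) (tangent p) (fun u : fiber TT p => u.1)).
Qed.

Lemma anchorE e : anchor (@TTstar_rho R n M) e = vpart e.
Proof. by apply: functional_extensionality_dep => p; rewrite /anchor TTstar_rhoE. Qed.

Lemma TTstar_form_linear p (a : R) (u u' v : fiber TT p) :
  TTstar_form (a *: u + u') v = a * TTstar_form u v + TTstar_form u' v.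
Proof.
rewrite /TTstar_form /= add_lfunE scale_lfunE linearP mulrBr opprD addrACA.
by rewrite -!addrA; congr (_ + _); rewrite addrCA.
Qed.

Lemma TTstar_form_skew p (u v : fiber TT p) : TTstar_form u v = - TTstar_form v u.
Proof. by rewrite /TTstar_form opprB. Qed.

Lemma TTstar_form_nondegenerate p (u : fiber TT p) :
  (forall v, TTstar_form u v = 0) -> u = 0.
Proof.
move=> H; have u2 : u.2 = 0.
  apply/lfunP => w; have := H (w, 0); rewrite /TTstar_form /= zero_lfunE subr0 => ->.
  by rewrite zero_lfunE.
have u1 : u.1 = 0.
  apply/rowP => k; pose xi : cotangent p := linfun (fun w : tangent p => (w : 'rV[R]_n) 0 k : R^o).
  have xiE (w : tangent p) : xi w = (w : 'rV[R]_n) 0 k :> R.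
    apply: (@linfun_linear _ (tangent p) R^o (fun w : tangent p => (w : 'rV[R]_n) 0 k : R^o)).
    by move=> l v v'; rewrite !mxE.
  have := H (0, xi); rewrite /TTstar_form /= linear0 sub0r => /eqP.
  by rewrite oppr_eq0 xiE => /eqP ->; rewrite mxE.
by case: u u1 u2 {H} => a b /= -> ->.
Qed.

(** D f is the differential of f: pairing with vectors and with covectors
    determines the two components. *)
Lemma gradientE (f : M -> R) p : smooth_at f p ->
  gradient (@TTstar_rho R n M) (@TTstar_form R n M) f p = (0, differential f p).
Proof.
move=> sf; apply: xget_subset1 => [u|u v Hu Hv].
  by rewrite /TTstar_form /= linear0 subr0 differentialE // TTstar_rhoE.
apply/eqP; rewrite -subr_eq0; apply/eqP; apply: TTstar_form_nondegenerate => w.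
by rewrite addrC -scaleN1r TTstar_form_linear Hu Hv mulN1r addNr.
Qed.

Lemma TTstar_vector_bundle : vector_bundle TT.
Proof.
exact: (sum_vector_bundle tangent_vector_bundle (dual_vector_bundle tangent_vector_bundle)).
Qed.

Lemma TTstar_frameE (ij : triv_index TT) p (w : 'rV[R]_(rank TT)) : triv_dom ij p ->
  frame ij p w = ((frame ij.1 p (lsubmx (w : 'rV[R]_(n + n))) : tangent p),
     (@dual_frame _ _ _ (tangent_bundle M) ij.2 p (rsubmx (w : 'rV[R]_(n + n))) : cotangent p)).
Proof.
move=> dp; rewrite (frame_sumE tangent_vector_bundle
  (dual_vector_bundle tangent_vector_bundle) _ dp).
congr pair; rewrite (@frame_dualE _ _ _ (tangent_bundle M)) //.
  exact: tangent_vector_bundle.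
by case: dp.
Qed.

Lemma TTstar_form_smooth (ij : triv_index TT) (w w' : 'rV[R]_(rank TT)) :
  smooth_on (triv_dom ij) (fun p => TTstar_form (frame ij p w) (frame ij p w')).
Proof.
have vT := @tangent_vector_bundle R n M; have vTd := dual_vector_bundle vT.
have od := open_sum_dom vT vTd ij.
apply/smooth_on_at => // p dp.
pose u : 'rV[R]_(n + n) := w; pose u' : 'rV[R]_(n + n) := w'.
pose G (a b : 'rV[R]_n) q := \sum_k a 0 k *
  @triv _ _ _ (tangent_bundle M) ij.2 q
    (@frame _ _ _ (tangent_bundle M) ij.1 q b) 0 k : R.
apply: (@smooth_at_eq _ _ _ _ (fun q =>
  G (rsubmx u) (lsubmx u') q - G (rsubmx u') (lsubmx u) q)).
  apply: filterS (near_sum_dom vT vTd dp) => q dq.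
  by rewrite !TTstar_frameE // /TTstar_form /= !(@dual_frameE _ _ _ (tangent_bundle M)).
case: dp => d1 d2.
apply: smooth_atB; apply: smooth_at_sum => k; apply: smooth_atZ; exact: smooth_at_triv_frame.
Qed.

Lemma TTstar_rho_smooth (ij : triv_index TT) (c : triv_index (tangent_bundle M))
   (w : 'rV[R]_(rank TT)) :
  smooth_on (triv_dom ij `&` triv_dom c) (fun p => triv c p (TTstar_rho p (frame ij p w))).
Proof.
have vT := @tangent_vector_bundle R n M; have vTd := dual_vector_bundle vT.
have od := open_sum_dom vT vTd ij.
apply/smooth_on_rV; first by apply: openI => //; exact: open_dom.
move=> k p [dp dc].
apply: (@smooth_at_eq _ _ _ _ (fun q => triv c q (frame ij.1 q (lsubmx (w : 'rV[R]_(n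
  + n)))) 0 k)).
  apply: filterS (near_sum_dom vT vTd dp) => q dq.
  by rewrite TTstar_rhoE TTstar_frameE.
by case: dp => d1 d2; exact: smooth_at_triv_frame.
Qed.

(** The 1-form part is a section of the dual of the tangent bundle. *)
Lemma TTstar_sectionP e : smooth_section e <-> smooth_vfield (vpart e) /\ smooth_form (fpart e).
Proof.
exact: (smooth_sum_section tangent_vector_bundle (dual_vector_bundle tangent_vector_bundle)).
Qed.

Lemma smooth_sform e1 e2 p : smooth_section e1 -> smooth_section e2 ->
  smooth_at (sform (@TTstar_form R n M) e1 e2) p.
Proof.
move=> /TTstar_sectionP [sx1 sxi1] /TTstar_sectionP [sx2 sxi2].
by apply: (@smooth_atB _ _ _ p (pairing (fpart e1) (vpart e2)) (pairing (fpart e2) (vpart e1)));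
  exact: smooth_pairing.
Qed.

Lemma act_sform x e1 e2 p : smooth_section e1 -> smooth_section e2 ->
  act x (sform (@TTstar_form R n M) e1 e2) p =
  act x (pairing (fpart e1) (vpart e2)) p - act x (pairing (fpart e2) (vpart e1)) p.
Proof.
move=> /TTstar_sectionP [sx1 sxi1] /TTstar_sectionP [sx2 sxi2].
by apply: actB; exact: smooth_pairing.
Qed.

Lemma sform_sub_gradient (k : R) (f : M -> R) e e' p : smooth_at f p ->
  sform (@TTstar_form R n M) (fun q => e q - k *:
      gradient (@TTstar_rho R n M) (@TTstar_form R n M) f q) e' p =
  sform (@TTstar_form R n M) e e' p - k * act (vpart e') f p.
Proof.
move=> sf; rewrite /sform gradientE // /TTstar_form /= scaler0 subr0 add_lfunE opp_lfunE.
by rewrite scale_lfunE differentialE // addrAC.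
Qed.

Lemma sformBr e e1 e2 p :
  sform (@TTstar_form R n M) e (fun q => e1 q - e2 q) p =
  sform (@TTstar_form R n M) e e1 p - sform (@TTstar_form R n M) e e2 p.
Proof.
rewrite /sform /TTstar_form /= linearB add_lfunE opp_lfunE.
exact: subrACA.
Qed.

Lemma smooth_section_lin (a : R) e e' : smooth_section e -> smooth_section e' ->
  smooth_section (fun q => a *: e q + e' q).
Proof.
move=> /(smooth_sectionP _ TTstar_vector_bundle) s /(smooth_sectionP _ TTstar_vector_bundle) s'.
apply/(smooth_sectionP _ TTstar_vector_bundle) => i k p dp.
under eq_fun do rewrite linearP !mxE.
by apply: smooth_atD; [apply: smooth_atZ; exact: s|exact: s'].
Qed.

Lemma covector_combination p (u1 u2 u3 u4 : fiber TT p) (v : tangent p) :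
  (u1 - u2 - (u3 - u4)).2 v = u1.2 v - u2.2 v - (u3.2 v - u4.2 v) :> R.
Proof. by rewrite /= !(add_lfunE, opp_lfunE). Qed.

Lemma covector_linear p (a : R) (f g : cotangent p) v : (a *: f + g) v = a * f v + g v :> R.
Proof. by rewrite add_lfunE scale_lfunE. Qed.

End Canonical.

(** * The product on a flat manifold *)

Section FlatManifold.
Context {R : realType} {n : nat} {M : manifold R n}.
Variables (nabla : connection_map M) (phi : tensor3 M).
Hypotheses (hconn : connection nabla) (hflat : flat nabla)
    (htors : torsion_free nabla) (hphi : smooth_tensor3 phi)
    (hsym : forall x y z : vfield M,
       smooth_vfield x -> smooth_vfield y -> smooth_vfield z ->
       forall p : M, phi p (x p) (y p) (z p) =
         phi p (x p) (z p) (y p) - phi p (z p) (x p) (y p)).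
Implicit Types (p q : M) (x y z : vfield M) (eta xi : form1 M).
Local Notation TT := (TTstar M).
Implicit Types e : section TT.

Let smooth_covar x y := @covar_smooth _ _ _ _ hconn x y.

Lemma nabla_linear (k : R) y z p (v : tangent p) : smooth_vfield y -> smooth_vfield z ->
  nabla (fun q => k *: y q + z q) p v = k *: nabla y p v + nabla z p v.
Proof.
move=> sy sz.
have sk : smooth_fun (fun _ : M => k) by apply/smooth_fun_at => q; exact: smooth_at_cst.
have sky : smooth_vfield (fun q => k *: y q).
  apply/smooth_vfieldP => i j q dq; under eq_fun do rewrite linearZ mxE.
  by apply: smooth_atZ; move: sy => /smooth_vfieldP; exact.
rewrite (nabla_add hconn sky sz) add_lfunE (nabla_leibniz hconn sk sy).
by rewrite deriv_along_cst scale0r add0r.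
Qed.

Lemma covar_linear (k : R) x y z p : smooth_vfield y -> smooth_vfield z ->
  covar nabla x (fun q => k *: y q + z q) p = k *: covar nabla x y p + covar nabla x z p.
Proof. exact: nabla_linear. Qed.

(** An equality of fields, so that it can be used under nabla, under a
    pairing that is differentiated, and in the first argument of phi. *)
Lemma lie_bracket_covar x y : smooth_vfield x -> smooth_vfield y ->
  lie_bracket x y = (fun q => covar nabla x y q - covar nabla y x q).
Proof. by move=> sx sy; apply: functional_extensionality_dep => q; rewrite htors. Qed.

Lemma act_covar_comm x y (f : M -> R) p : smooth_vfield x -> smooth_vfield y ->
  smooth_at f p ->
  act x (act y f) p - act y (act x f) p =
  act (covar nabla x y) f p - act (covar nabla y x) f p.
Proof.
by move=> sx sy sf; rewrite -act_bracket // lie_bracket_covar // act_fieldB.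
Qed.

Lemma flat_covar x y z p : smooth_vfield x -> smooth_vfield y -> smooth_vfield z ->
  covar nabla x (covar nabla y z) p - covar nabla y (covar nabla x z) p =
  covar nabla (covar nabla x y) z p - covar nabla (covar nabla y x) z p.
Proof.
move=> sx sy sz; have /eqP := hflat sx sy sz p; rewrite subr_eq0 => /eqP ->.
by rewrite lie_bracket_covar // /covar linearB.
Qed.

Definition phi_fun x y z : M -> R := fun q => phi q (x q) (y q) (z q).

(** Smoothness of phi is given for coordinate fields with constant
    coefficients; this expansion extends it to all smooth fields. *)
Lemma trilinear_sum p (u v w : 'rV[R]_n) (i : triv_index (tangent_bundle M)) :
  phi p (frame i p u) (frame i p v) (frame i p w) =
  \sum_a \sum_b \sum_c u 0 a * (v 0 b * (w 0 c *
     phi p (frame i p 'e_a) (frame i p 'e_b) (frame i p 'e_c))) :> R.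
Proof.
pose f := frame i p.
have H1 (V W : tangent p) : phi p (f u) V W = \sum_a u 0 a * phi p (f 'e_a) V W :> R.
  rewrite {1}(row_sum_delta u) !linear_sum !sum_lfunE; apply: eq_bigr => a _.
  by rewrite !linearZ !scale_lfunE.
have H2 (V W : tangent p) : phi p V (f v) W = \sum_a v 0 a * phi p V (f 'e_a) W :> R.
  rewrite {1}(row_sum_delta v) !linear_sum !sum_lfunE; apply: eq_bigr => a _.
  by rewrite !linearZ !scale_lfunE.
have H3 (V W : tangent p) : phi p V W (f w) = \sum_a w 0 a * phi p V W (f 'e_a) :> R.
  by rewrite {1}(row_sum_delta w) !linear_sum; apply: eq_bigr => a _; rewrite !linearZ.
rewrite H1; apply: eq_bigr => a _; rewrite H2 mulr_sumr; apply: eq_bigr => b _.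
by rewrite H3 !mulr_sumr.
Qed.

Lemma smooth_phi x y z p : smooth_vfield x -> smooth_vfield y -> smooth_vfield z ->
  smooth_at (phi_fun x y z) p.
Proof.
move=> /smooth_vfieldP sx /smooth_vfieldP sy /smooth_vfieldP sz.
have dp := dom_chart_at p; pose i := chart_index p.
apply: (@smooth_at_eq _ _ _ _ (fun q => \sum_a \sum_b \sum_c triv i q (x q) 0 a *
   (triv i q (y q) 0 b * (triv i q (z q) 0 c *
    phi q (frame i q 'e_a) (frame i q 'e_b) (frame i q 'e_c))))).
  have := near_dom dp; apply: filterS => q dq.
  by rewrite -trilinear_sum !tangent_trivK.
apply: smooth_at_sum => a; apply: smooth_at_sum => b; apply: smooth_at_sum => c.
apply: smooth_atM; first exact: sx.
apply: smooth_atM; first exact: sy.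
apply: smooth_atM; first exact: sz.
have [+ _] := smooth_on_at (fun q => phi q (frame i q 'e_a) (frame i q 'e_b) (frame i q 'e_c) : R)
  (open_dom (sval i)).
by move=> /(_ (hphi i 'e_a 'e_b 'e_c)) /(_ p dp).
Qed.

Local Notation star := (TTstar_star nabla phi).
Local Notation form := (@TTstar_form R n M).
Local Notation rho := (@TTstar_rho R n M).

(** lie_derivE and vanishing torsion express the 1-form part of the product
    by nabla alone. *)
Lemma star_fpart_at e1 e2 z p : smooth_section e1 -> smooth_section e2 -> smooth_vfield z ->
  pairing (fpart (star e1 e2)) z p =
  act (vpart e1) (pairing (fpart e2) z) p
  - (pairing (fpart e2) (covar nabla (vpart e1) z) p
    - pairing (fpart e2) (covar nabla z (vpart e1)) p)
  + pairing (fpart e1) (covar nabla z (vpart e2)) p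
  - 2^-1 * (act z (pairing (fpart e1) (vpart e2)) p + act z (pairing (fpart e2) (vpart e1)) p)
  + phi_fun (vpart e1) (vpart e2) z p.
Proof.
move=> /TTstar_sectionP [sx1 sxi1] /TTstar_sectionP [sx2 sxi2] sz.
rewrite [LHS]/pairing [fpart _ _]/= !add_lfunE !opp_lfunE scale_lfunE.
rewrite lie_derivE // lie_bracket_covar // pairingB.
rewrite comp_lfunE opprK differentialE; last first.
  by apply: smooth_atD; exact: smooth_pairing.
have -> : deriv_along (z p) (TTstar_plus e1 e2) =
    act z (pairing (fpart e1) (vpart e2)) p + act z (pairing (fpart e2) (vpart e1)) p.
  by apply: deriv_alongD; exact: smooth_pairing.
by [].
Qed.

Lemma star_fpart e1 e2 z : smooth_section e1 -> smooth_section e2 -> smooth_vfield z ->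
  pairing (fpart (star e1 e2)) z = (fun p =>
  act (vpart e1) (pairing (fpart e2) z) p
  - (pairing (fpart e2) (covar nabla (vpart e1) z) p
    - pairing (fpart e2) (covar nabla z (vpart e1)) p)
  + pairing (fpart e1) (covar nabla z (vpart e2)) p
  - 2^-1 * (act z (pairing (fpart e1) (vpart e2)) p + act z (pairing (fpart e2) (vpart e1)) p)
  + phi_fun (vpart e1) (vpart e2) z p).
Proof. by move=> s1 s2 sz; apply/funext => p; exact: star_fpart_at. Qed.

Lemma smooth_star e1 e2 : smooth_section e1 -> smooth_section e2 -> smooth_section (star e1 e2).
Proof.
move=> s1 s2; have [sx1 sxi1] := (TTstar_sectionP e1).1 s1.
have [sx2 sxi2] := (TTstar_sectionP e2).1 s2.
apply/TTstar_sectionP; split; first exact: smooth_covar.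
apply: smooth_form_test => z p sz; rewrite star_fpart //.
apply: smooth_atD; last exact: smooth_phi.
apply: smooth_atB.
  apply: smooth_atD; last by apply: smooth_pairing => //; exact: smooth_covar.
  apply: smooth_atB; first by apply: smooth_at_act => //; exact: smooth_pairing.
  by apply: smooth_atB; apply: smooth_pairing => //; exact: smooth_covar.
apply: smooth_atZ.
by apply: smooth_atD; apply: smooth_at_act => //; exact: smooth_pairing.
Qed.

(** Iterated products differentiate the previous formula once more. *)
Lemma act_star_fpart w e1 e2 z p : smooth_section e1 -> smooth_section e2 -> smooth_vfield z ->
  act w (pairing (fpart (star e1 e2)) z) p =
  act w (act (vpart e1) (pairing (fpart e2) z)) p
  - (act w (pairing (fpart e2) (covar nabla (vpart e1) z)) p
     - act w (pairing (fpart e2) (covar nabla z (vpart e1))) p)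
  + act w (pairing (fpart e1) (covar nabla z (vpart e2))) p
  - 2^-1 * (act w (act z (pairing (fpart e1) (vpart e2))) p
            + act w (act z (pairing (fpart e2) (vpart e1))) p)
  + act w (phi_fun (vpart e1) (vpart e2) z) p.
Proof.
move=> s1 s2 sz; have [sx1 sxi1] := (TTstar_sectionP e1).1 s1.
have [sx2 sxi2] := (TTstar_sectionP e2).1 s2.
rewrite star_fpart //.
have sp eta x : smooth_form eta -> smooth_vfield x -> smooth_at (pairing eta x) p.
  exact: smooth_pairing.
have sa x eta y : smooth_vfield x -> smooth_form eta -> smooth_vfield y ->
    smooth_at (act x (pairing eta y)) p.
  by move=> sx se sy; apply: smooth_at_act => //; exact: smooth_pairing.
have c1 := smooth_covar sx1 sz; have c2 := smooth_covar sz sx1; have c3 := smooth_covar sz sx2.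
have h1 := sa _ _ _ sx1 sxi2 sz; have h2 := sa _ _ _ sz sxi1 sx2;
have h3 := sa _ _ _ sz sxi2 sx1.
have k1 := sp _ _ sxi2 c1; have k2 := sp _ _ sxi2 c2; have k3 := sp _ _ sxi1 c3.
have l1 := smooth_phi p sx1 sx2 sz.
have m1 := smooth_atB k1 k2; have m2 := smooth_atB h1 m1; have m3 := smooth_atD m2 k3.
have m4 := smooth_atD h2 h3; have m5 := smooth_atZ 2^-1 m4.
rewrite (actD _ (smooth_atB m3 m5) l1) (actB _ m3 m5) (actD _ m2 k3) (actB _ h1 m1) (actB _ k1 k2).
by rewrite (actZ _ _ m4) (actD _ h2 h3).
Qed.

Local Notation SX := {x : vfield M | smooth_vfield x}.
Local Notation SF := {xi : form1 M | smooth_form xi}.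
Local Notation SA := {f : M -> R | forall p, smooth_at f p}.

(** Smooth functions, fields and 1-forms are bundled with their smoothness
    proofs so that the algebra of the product applies without side
    conditions. *)
Definition s_act (x : SX) (f : SA) : SA :=
  exist (fun f : M -> R => forall p, smooth_at f p)
    (act (sval x) (sval f)) (fun p => smooth_at_act (svalP x) (svalP f p)).

Definition s_covar (x y : SX) : SX :=
  exist _ (covar nabla (sval x) (sval y)) (smooth_covar (svalP x) (svalP y)).

Definition s_pairing (xi : SF) (x : SX) : SA :=
  exist (fun f : M -> R => forall p, smooth_at f p)
    (pairing (sval xi) (sval x)) (fun p => smooth_pairing p (svalP xi) (svalP x)).

Definition s_phi (x y z : SX) : SA :=
  exist (fun f : M -> R => forall p, smooth_at f p)
   (phi_fun (sval x) (sval y) (sval z))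
    (fun p => smooth_phi p (svalP x) (svalP y) (svalP z)).

Definition s_section (x : SX) (xi : SF) : section TT := fun q => (sval x q, sval xi q).

Lemma smooth_s_section (x : SX) (xi : SF) : smooth_section (s_section x xi).
Proof. by apply/TTstar_sectionP; split; [exact: (svalP x)|exact: (svalP xi)]. Qed.

Definition s_star (x : SX) (xi : SF) (y : SX) (eta : SF) : SF :=
  exist _ (fpart (star (s_section x xi) (s_section y eta)))
    (((TTstar_sectionP _).1 (smooth_star
        (smooth_s_section x xi) (smooth_s_section y eta))).2).

Definition value_at p (f : SA) : R := sval f p.

Lemma s_act_comm p (x y : SX) f :
  value_at p (s_act x (s_act y f)) - value_at p (s_act y (s_act x f)) =
  value_at p (s_act (s_covar x y) f) - value_at p (s_act (s_covar y x) f).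
Proof.
exact: (act_covar_comm (svalP x) (svalP y) (svalP f p)).
Qed.

Lemma s_flat p (xi : SF) (x y z : SX) :
  value_at p (s_pairing xi (s_covar x (s_covar y z)))
  - value_at p (s_pairing xi (s_covar y (s_covar x z))) =
  value_at p (s_pairing xi (s_covar (s_covar x y) z))
  - value_at p (s_pairing xi (s_covar (s_covar y x) z)).
Proof.
have := congr1 (sval xi p) (flat_covar p (svalP x) (svalP y) (svalP z)).
by rewrite !(linearB (sval xi p)).
Qed.

Lemma s_phi_cyclic p (x y z : SX) :
  value_at p (s_phi x y z) = value_at p (s_phi x z y) - value_at p (s_phi z x y).
Proof. exact: (hsym (svalP x) (svalP y) (svalP z)). Qed.

Lemma s_act_phi_cyclic p (w x y z : SX) :
  value_at p (s_act w (s_phi x y z)) =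
  value_at p (s_act w (s_phi x z y)) - value_at p (s_act w (s_phi z x y)).
Proof.
rewrite /value_at /= -actB; [|exact: (svalP (s_phi x z y))|exact: (svalP (s_phi z x y))].
congr (act _ _ p); apply/funext => q; exact: s_phi_cyclic.
Qed.

Lemma s_star_pairing p (x : SX) (xi : SF) (y : SX) (eta : SF) (z : SX) :
  value_at p (s_pairing (s_star x xi y eta) z) =
  value_at p (s_act x (s_pairing eta z))
  - (value_at p (s_pairing eta (s_covar x z)) - value_at p (s_pairing eta (s_covar z x)))
  + value_at p (s_pairing xi (s_covar z y))
  - 2^-1 * (value_at p (s_act z (s_pairing xi y)) + value_at p (s_act z (s_pairing eta x)))
  + value_at p (s_phi x y z).
Proof.
exact: (star_fpart_at p
  (smooth_s_section x xi) (smooth_s_section y eta) (svalP z)).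
Qed.

Lemma s_act_star_pairing p (w x : SX) (xi : SF) (y : SX) (eta : SF) (z : SX) :
  value_at p (s_act w (s_pairing (s_star x xi y eta) z)) =
  value_at p (s_act w (s_act x (s_pairing eta z)))
  - (value_at p (s_act w (s_pairing eta (s_covar x z)))
     - value_at p (s_act w (s_pairing eta (s_covar z x))))
  + value_at p (s_act w (s_pairing xi (s_covar z y)))
  - 2^-1 * (value_at p (s_act w (s_act z (s_pairing xi y)))
            + value_at p (s_act w (s_act z (s_pairing eta x))))
  + value_at p (s_act w (s_phi x y z)).
Proof.
exact: (act_star_fpart (sval w) p
  (smooth_s_section x xi) (smooth_s_section y eta) (svalP z)).
Qed.

Definition s_vpart e (se : smooth_section e) : SX := exist _ (vpart e) ((TTstar_sectionP e).1 se).1.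
Definition s_fpart e (se : smooth_section e) : SF := exist _ (fpart e) ((TTstar_sectionP e).1 se).2.

Lemma star_invariance e1 e2 e3 p : smooth_section e1 -> smooth_section e2 ->
  smooth_section e3 ->
  act (anchor rho e1) (sform form e2 e3) p =
  sform form (fun q => star e1 e2 q - 2%:R^-1 *:
      gradient rho form
        (sform form e1 e2) q) e3 p
  + sform form e2 (star_bracket star e1 e3) p.
Proof.
move=> s1 s2 s3.
have H := @star_form_invariance R SX SA SF (value_at p) s_act s_covar s_pairing
  s_phi s_star (s_phi_cyclic p) (s_star_pairing p)
  (s_vpart s1) (s_vpart s2) (s_vpart s3)
  (s_fpart s1) (s_fpart s2) (s_fpart s3).
rewrite anchorE act_sform //; apply: etrans H _.
rewrite sform_sub_gradient ?act_sform; [|by []|by []|exact: smooth_sform].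
rewrite sformBr; exact: invariance_regroup.
Qed.

Lemma smooth_Tfun e1 e2 e3 p : smooth_section e1 -> smooth_section e2 -> smooth_section e3 ->
  smooth_at (Tfun star form e1 e2 e3) p.
Proof.
move=> s1 s2 s3.
have h1 := smooth_sform p (smooth_star s1 s2) s3;
have h2 := smooth_sform p s1 (smooth_star s2 s3).
have h3 := smooth_sform p (smooth_star s2 s1) s3;
have h4 := smooth_sform p s2 (smooth_star s1 s3).
exact: smooth_atB (smooth_atB (smooth_atD h1 h2) h3) h4.
Qed.

Lemma act_Tfun z e1 e2 e3 p : smooth_section e1 -> smooth_section e2 -> smooth_section e3 ->
  act z (Tfun star form e1 e2 e3) p =
  act z (sform form (star e1 e2) e3) p + act z (sform form e1 (star e2 e3)) p
  - act z (sform form (star e2 e1) e3) p - act z (sform form e2 (star e1 e3)) p.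
Proof.
move=> s1 s2 s3.
have h1 := smooth_sform p (smooth_star s1 s2) s3;
have h2 := smooth_sform p s1 (smooth_star s2 s3).
have h3 := smooth_sform p (smooth_star s2 s1) s3;
have h4 := smooth_sform p s2 (smooth_star s1 s3).
have k := smooth_atD h1 h2.
by rewrite -(actD z h1 h2) -(actB z k h3) -(actB z (smooth_atB k h3) h4).
Qed.

Lemma phi_bracket x y z w p : smooth_vfield x -> smooth_vfield y ->
  phi p (lie_bracket x y p) (z p) (w p) =
  phi_fun (covar nabla x y) z w p - phi_fun (covar nabla y x) z w p.
Proof.
move=> sx sy; rewrite (lie_bracket_covar sx sy) linearB.
by rewrite add_lfunE opp_lfunE add_lfunE opp_lfunE.
Qed.

Lemma coboundary_swap x1 x2 x3 x4 p : smooth_vfield x1 -> smooth_vfield x2 ->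
  smooth_vfield x3 ->
  coboundary nabla (tensor_swap phi) x1 x2 x3 x4 p =
  act x1 (phi_fun x2 x4 x3) p - act x2 (phi_fun x1 x4 x3) p
  + act x3 (phi_fun x1 x4 x2) p
  - (phi_fun x2 (covar nabla x1 x4) x3 p - phi_fun x1 (covar nabla x2 x4) x3 p
     + phi_fun x1 (covar nabla x3 x4) x2 p)
  + (- (phi_fun (covar nabla x1 x2) x4 x3 p - phi_fun (covar nabla x2 x1) x4 x3 p)
     + (phi_fun (covar nabla x1 x3) x4 x2 p - phi_fun (covar nabla x3 x1) x4 x2 p)
     - (phi_fun (covar nabla x2 x3) x4 x1 p - phi_fun (covar nabla x3 x2) x4 x1 p)).
Proof.
move=> sx1 sx2 sx3.
have B x y z w : smooth_vfield x -> smooth_vfield y ->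
   tensor_swap phi (lie_bracket x y) w z p =
   phi_fun (covar nabla x y) z w p - phi_fun (covar nabla y x) z w p.
  exact: phi_bracket.
exact: (congr_tail _ (B _ _ x4 x3 sx1 sx2) (B _ _ x4 x2 sx1 sx3) (B _ _ x4 x1 sx2 sx3)).
Qed.

(** The failure of the associator axiom at (e1, e2, e3), evaluated on z,
    only depends on the vector parts of the e_i. *)
Lemma associator_defect e1 e2 e3 z p :
  smooth_section e1 -> smooth_section e2 -> smooth_section e3 -> smooth_vfield z ->
  (associator star e1 e2 e3 p - associator star e2 e1 e3 p).2 (z p)
  - 6%:R^-1 * act z (Tfun star form e1 e2 e3) p =
  coboundary nabla (tensor_swap phi) (vpart e1) (vpart e2) z (vpart e3) p.
Proof.
move=> s1 s2 s3 sz.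
have sx1 := ((TTstar_sectionP e1).1 s1).1; have sx2 := ((TTstar_sectionP e2).1 s2).1.
have sx3 := ((TTstar_sectionP e3).1 s3).1.
have H := @star_associator_defect _ _ _ _ _ _ _ _ _ _ (s_act_comm p) (s_flat p)
  (s_phi_cyclic p) (s_act_phi_cyclic p)
  (s_star_pairing p) (s_act_star_pairing p)
  (s_vpart s1) (s_vpart s2) (s_vpart s3) (exist _ z sz)
  (s_fpart s1) (s_fpart s2) (s_fpart s3).
rewrite covector_combination act_Tfun //.
rewrite (act_sform z p (smooth_star s1 s2) s3) (act_sform z p s1 (smooth_star s2 s3)).
rewrite (act_sform z p (smooth_star s2 s1) s3) (act_sform z p s2 (smooth_star s1 s3)).
rewrite coboundary_swap //; exact: H.
Qed.

Lemma associator_vpart e1 e2 e3 p :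
  smooth_section e1 -> smooth_section e2 -> smooth_section e3 ->
  (associator star e1 e2 e3 p - associator star e2 e1 e3 p).1 = 0.
Proof.
move=> s1 s2 s3.
have sx1 := ((TTstar_sectionP e1).1 s1).1; have sx2 := ((TTstar_sectionP e2).1 s2).1.
have sx3 := ((TTstar_sectionP e3).1 s3).1.
have := flat_covar p sx1 sx2 sx3.
move=> /eqP; rewrite subr_eq => /eqP E.
change (covar nabla (vpart e1) (covar nabla (vpart e2) (vpart e3)) p
 - covar nabla (covar nabla (vpart e1) (vpart e2)) (vpart e3) p
 - (covar nabla (vpart e2) (covar nabla (vpart e1) (vpart e3)) p
   - covar nabla (covar nabla (vpart e2) (vpart e1)) (vpart e3) p) = 0).
rewrite E; apply/eqP; rewrite subr_eq0; apply/eqP.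
by rewrite addrAC addrC; congr (_ + _); rewrite addrAC subrr sub0r.
Qed.

Lemma associator_closed e1 e2 e3 p : closed_cochain nabla (tensor_swap phi) ->
  smooth_section e1 -> smooth_section e2 -> smooth_section e3 ->
  associator star e1 e2 e3 p - associator star e2 e1 e3 p =
  6%:R^-1 *: gradient rho form (Tfun star form e1 e2 e3) p.
Proof.
move=> cl s1 s2 s3.
have sx1 := ((TTstar_sectionP e1).1 s1).1; have sx2 := ((TTstar_sectionP e2).1 s2).1.
have sx3 := ((TTstar_sectionP e3).1 s3).1.
have sT := smooth_Tfun p s1 s2 s3.
rewrite (gradientE sT).
have E1 := associator_vpart p s1 s2 s3.
have E2 : (associator star e1 e2 e3 p - associator star e2 e1 e3 p).2 =
   6%:R^-1 *: differential (Tfun star form e1 e2 e3) p.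
  apply/lfunP => v; have [z sz <-] := @extend_tangent _ _ _ p v.
  rewrite scale_lfunE differentialE //; apply/eqP; rewrite -subr_eq0; apply/eqP.
  by rewrite (associator_defect p s1 s2 s3 sz) cl.
by apply: injective_projections; rewrite ?E1 ?E2 //= scaler0.
Qed.

(** On sections with zero 1-form part, the associator axiom is the vanishing
    of the coboundary. *)
Lemma closed_of_associator :
  (forall e1 e2 e3, smooth_section e1 -> smooth_section e2 -> smooth_section e3 ->
    forall p, associator star e1 e2 e3 p - associator star e2 e1 e3 p =
      6%:R^-1 *: gradient rho form (Tfun star form e1 e2 e3) p) ->
  closed_cochain nabla (tensor_swap phi).
Proof.
move=> H x1 x2 z x3 sx1 sx2 sz sx3 p.
pose e x : section TT := fun q => (x q, 0).
have se x : smooth_vfield x -> smooth_section (e x).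
  by move=> sx; apply/TTstar_sectionP; split => //; exact: smooth_form0.
have sT := smooth_Tfun p (se _ sx1) (se _ sx2) (se _ sx3).
rewrite -[LHS](associator_defect p (se _ sx1) (se _ sx2) (se _ sx3) sz).
rewrite H ?(gradientE sT) /=; try exact: se.
by rewrite scale_lfunE differentialE // subrr.
Qed.

(** Equality of 1-forms is tested on global fields, where each term of
    star_fpart is linear. *)
Lemma star_linear_left (a : R) e1 e1' e2 p : smooth_section e1 -> smooth_section e1' ->
  smooth_section e2 ->
  star (fun q => a *: e1 q + e1' q) e2 p = a *: star e1 e2 p + star e1' e2 p.
Proof.
move=> s1 s1' s2; have sl := smooth_section_lin a s1 s1'.
have [sx1 sxi1] := (TTstar_sectionP e1).1 s1; have [sx1' sxi1'] := (TTstar_sectionP e1').1 s1'.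
have [sx2 sxi2] := (TTstar_sectionP e2).1 s2.
have V : vpart (fun q => a *: e1 q + e1' q) = (fun q => a *: vpart e1 q + vpart e1' q) by [].
have F : fpart (fun q => a *: e1 q + e1' q) = (fun q => a *: fpart e1 q + fpart e1' q) by [].
have E1 : (star (fun q => a *: e1 q + e1' q) e2 p).1 =
  a *: (star e1 e2 p).1 + (star e1' e2 p).1.
  exact: (linearP (nabla (vpart e2) p)).
have E2 : (star (fun q => a *: e1 q + e1' q) e2 p).2 =
  a *: (star e1 e2 p).2 + (star e1' e2 p).2.
  apply/lfunP => v; have [z sz <-] := @extend_tangent _ _ _ p v.
  rewrite [RHS]covector_linear.
  have H := star_fpart_at p sl s2 sz.
  have H1 := star_fpart_at p s1 s2 sz.
  have H2 := star_fpart_at p s1' s2 sz.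
  apply: etrans H _; apply: etrans _ (linear_congr a H1 H2).
  rewrite V F; apply: etrans; last exact: linear_regroup.
  rewrite act_field_lin; last exact: smooth_pairing.
  have sp xi x : smooth_form xi -> smooth_vfield x -> smooth_at (pairing xi x) p.
    by move=> *; exact: smooth_pairing.
  have C1 : pairing (fpart e2) (covar nabla (fun q => a *: vpart e1 q + vpart e1' q) z) p =
     a * pairing (fpart e2) (covar nabla (vpart e1) z) p
       + pairing (fpart e2) (covar nabla (vpart e1') z) p.
    by rewrite /pairing /covar !linearP.
  have C2 : pairing (fpart e2) (covar nabla z (fun q => a *: vpart e1 q + vpart e1' q)) p =
     a * pairing (fpart e2) (covar nabla z (vpart e1)) p
       + pairing (fpart e2) (covar nabla z (vpart e1')) p.
    by rewrite /pairing (covar_linear) // linearP.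
  have C3 : phi_fun (fun q => a *: vpart e1 q + vpart e1' q) (vpart e2) z p =
    a * phi_fun (vpart e1) (vpart e2) z p + phi_fun (vpart e1') (vpart e2) z p.
    by rewrite /phi_fun linearP !add_lfunE !scale_lfunE.
  rewrite C1 C2 C3 pairing_lin !pairing_linl act_lin; [|exact: sp|exact: sp].
  by rewrite act_lin //; exact: sp.
exact: injective_projections.
Qed.

Lemma star_linear_right (a : R) e1 e2 e2' p : smooth_section e1 -> smooth_section e2 ->
  smooth_section e2' ->
  star e1 (fun q => a *: e2 q + e2' q) p = a *: star e1 e2 p + star e1 e2' p.
Proof.
move=> s1 s2 s2'; have sl := smooth_section_lin a s2 s2'.
have [sx1 sxi1] := (TTstar_sectionP e1).1 s1; have [sx2' sxi2'] := (TTstar_sectionP e2').1 s2'.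
have [sx2 sxi2] := (TTstar_sectionP e2).1 s2.
have V : vpart (fun q => a *: e2 q + e2' q) = (fun q => a *: vpart e2 q + vpart e2' q) by [].
have F : fpart (fun q => a *: e2 q + e2' q) = (fun q => a *: fpart e2 q + fpart e2' q) by [].
have E1 : (star e1 (fun q => a *: e2 q + e2' q) p).1 =
  a *: (star e1 e2 p).1 + (star e1 e2' p).1.
  exact: (covar_linear).
have E2 : (star e1 (fun q => a *: e2 q + e2' q) p).2 =
  a *: (star e1 e2 p).2 + (star e1 e2' p).2.
  apply/lfunP => v; have [z sz <-] := @extend_tangent _ _ _ p v.
  rewrite [RHS]covector_linear.
  have H := star_fpart_at p s1 sl sz.
  have H1 := star_fpart_at p s1 s2 sz.
  have H2 := star_fpart_at p s1 s2' sz.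
  apply: etrans H _; apply: etrans _ (linear_congr a H1 H2).
  rewrite V F; apply: etrans; last exact: linear_regroup.
  have sp xi x : smooth_form xi -> smooth_vfield x -> smooth_at (pairing xi x) p.
    by move=> *; exact: smooth_pairing.
  have C2 : pairing (fpart e1) (covar nabla z (fun q => a *: vpart e2 q + vpart e2' q)) p =
     a * pairing (fpart e1) (covar nabla z (vpart e2)) p
       + pairing (fpart e1) (covar nabla z (vpart e2')) p.
    by rewrite /pairing (covar_linear) // linearP.
  have C3 : phi_fun (vpart e1) (fun q => a *: vpart e2 q + vpart e2' q) z p =
    a * phi_fun (vpart e1) (vpart e2) z p + phi_fun (vpart e1) (vpart e2') z p.
    by rewrite /phi_fun linearP !add_lfunE !scale_lfunE.
  rewrite C2 C3 pairing_lin !pairing_linl act_lin; [|exact: sp|exact: sp].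
  rewrite act_lin; [|exact: sp|exact: sp].
  by rewrite act_lin //; exact: sp.
exact: injective_projections.
Qed.

End FlatManifold.

Theorem proposition4p2 (R : realType) (n : nat) (M : manifold R n)
    (nabla : connection_map M) (phi : tensor3 M)
    (hconn : connection nabla) (hflat : flat nabla)
    (htors : torsion_free nabla) (hphi : smooth_tensor3 phi)
    (hsym : forall x y z : vfield M,
       smooth_vfield x -> smooth_vfield y -> smooth_vfield z ->
       forall p : M, phi p (x p) (y p) (z p) =
         phi p (x p) (z p) (y p) - phi p (z p) (x p) (y p)) :
  pre_symplectic_algebroid (TTstar_star nabla phi) (@TTstar_rho R n M)
      (@TTstar_form R n M)
  <-> closed_cochain nabla (tensor_swap phi).
Proof.
split=> [psa|cl].
  apply: (closed_of_associator hconn hflat htors hphi hsym) => e1 e2 e3 s1 s2 s3 p.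
  exact: (star_associator psa).
split.
- exact: TTstar_vector_bundle.
- by move=> p; exact: TTstar_form_linear.
- by move=> p; exact: TTstar_form_skew.
- by move=> p; exact: TTstar_form_nondegenerate.
- exact: TTstar_form_smooth.
- exact: TTstar_rho_smooth.
- by move=> e1 e2; exact: smooth_star.
- by move=> a e1 e1' e2 s1 s1' s2 p; exact: star_linear_left.
- by move=> a e1 e2 e2' s1 s2 s2' p; exact: star_linear_right.
- by move=> e1 e2 e3 s1 s2 s3 p; exact: associator_closed.
- by move=> e1 e2 e3 s1 s2 s3 p; exact: star_invariance.
Qed.
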